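(* Let $K:\mathcal X\times\mathcal X\to\mathbb{R}$ be a Mercer kernel with $\sup_{x\in\mathcal X}K(x,x)\le\kappa^2<\infty$, let $\rho_1,\rho_2$ be probability distributions on $\mathcal X$, and fix $r\ge1$. For $k\in\{1,2\}$ let $\mathcal D_{k,1}\ge\mathcal D_{k,2}\ge\cdots$ be the eigenvalues of the centered kernel covariance operator $M_{K,k}$ of $\rho_k$ and assume $$\mathcal D_{k,1}\ge\cdots\ge\mathcal D_{k,r}>\mathcal D_{k,r+1},\qquad \min_{1\le j\le r}(\mathcal D_{k,j}-\mathcal D_{k,j+1})>0.$$ Let $$\Pi^{(K)}_r(\rho_k)=\frac{(\mathcal D_{k,1},\dots,\mathcal D_{k,r})}{\sum_{j=1}^r\mathcal D_{k,j}},\qquad d_r^{(K)}(\rho_1,\rho_2)=\bigl\|\Pi_r^{(K)}(\rho_1)-\Pi_r^{(K)}(\rho_2)\bigr\|_2,$$ and, with $\hat{\mathcal D}_{k,1}\ge\dots\ge\hat{\mathcal D}_{k,r}$ the leading $r$ eigenvalues of the normalized centered Gram matrix $G_k$ of $N_k$ i.i.d. samples from $\rho_k$, $$\widehat\Pi^{(K)}_{r,k}=\frac{(\hat{\mathcal D}_{k,1},\dots,\hat{\mathcal D}_{k,r})}{\sum_{j=1}^r\hat{\mathcal D}_{k,j}},\qquad \widehat d^{(K)}_r=\bigl\|\widehat\Pi^{(K)}_{r,1}-\widehat\Pi^{(K)}_{r,2}\bigr\|_2.$$ Then, as $N_1,N_2\to\infty$, $\widehat\Pi^{(K)}_{r,k}\xrightarrow{\mathbb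 P}\Pi_r^{(K)}(\rho_k)$ for $k=1,2$, and consequently $\widehat d_r^{(K)}\xrightarrow{\mathbb P}d_r^{(K)}(\rho_1,\rho_2)$.
   Context: $(\mathcal X,\mathcal B)$ is a measurable space; $K$ has reproducing kernel Hilbert space $\mathcal H_K$ and feature map $\phi:\mathcal X\to\mathcal H_K$ with $K(x,y)=\langle\phi(x),\phi(y)\rangle_{\mathcal H_K}$. Put $m_k=\mathbb{E}_{X\sim\rho_k}[\phi(X)]$ and $M_{K,k}=\mathbb{E}_{X\sim\rho_k}[(\phi(X)-m_k)\otimes(\phi(X)-m_k)]$, where $(u\otimes v)f=\langle f,v\rangle_{\mathcal H_K}u$; this is a self-adjoint positive trace-class operator. Given i.i.d. samples $x_{k,1},\dots,x_{k,N_k}$ from $\rho_k$, the centered Gram matrix has entries $[\widetilde K_k]_{ij}=\langle\phi(x_{k,i})-m_k,\phi(x_{k,j})-m_k\rangle_{\mathcal H_K}$, and $G_k=\frac1{N_k}\widetilde K_k$. *)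

(* Defs.v *)
From mathcomp Require Import all_boot all_order all_algebra sesquilinear.
From mathcomp Require Import all_classical all_reals all_analysis.

Set Implicit Arguments.
Unset Strict Implicit.
Unset Printing Implicit Defensive.

Import Order.TTheory GRing.Theory Num.Theory numFieldNormedType.Exports.

Local Open Scope classical_set_scope.
Local Open Scope card_scope.
Local Open Scope ring_scope.

(* The underlying space is only a measurable space, so the regularity required
   of a Mercer kernel is joint measurability rather than continuity. *)
Definition mercer_kernel d (X : measurableType d) (R : realType)
    (K : X -> X -> R) : Prop :=
  [/\ (forall x y, K x y = K y x),
      (forall n (x : 'I_n -> X) (c : 'I_n -> R),
         0 <= \sum_(i < n) \sum_(j < n) c i * c j * K (x i) (x j)) &
      measurable_fun setT (fun z : X * X => K z.1 z.2)].

(* With [H] complete, this makes [H] a real Hilbert space. *)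
Definition norm_from_inner (R : realType) (H : completeNormedModType R)
    (ip : {dot H for idfun}) : Prop :=
  forall f, `|f| ^+ 2 = ip f f.

(* [ev] views the elements of [H] as functions on [X]; [kx] below is the
   section [K x] seen as an element of [H]. *)
Definition is_rkhs (X : Type) (R : realType) (H : completeNormedModType R)
    (ip : {dot H for idfun}) (ev : H -> X -> R) (K : X -> X -> R) : Prop :=
  [/\ norm_from_inner ip,
      (forall (a : R) f g x, ev (a *: f + g) x = a * ev f x + ev g x),
      injective ev &
      forall x, exists kx : H,
        (forall y, ev kx y = K x y) /\ (forall f, ev f x = ip f kx)].

Definition feature_map (X : Type) (R : realType) (H : completeNormedModType R)
    (ip : {dot H for idfun}) (K : X -> X -> R) (phi : X -> H) : Prop :=
  forall x y, K x y = ip (phi x) (phi y).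

(* [m] is the expectation of [Z] under [rho], in the weak (Pettis) sense; it is
   unique, and it is the Bochner integral whenever the latter exists. *)
Definition is_expectation d (X : measurableType d) (R : realType)
    (H : completeNormedModType R) (ip : {dot H for idfun})
    (rho : probability X R) (Z : X -> H) (m : H) : Prop :=
  forall g : H, rho.-integrable setT (EFin \o (fun x => ip (Z x) g)) /\
                ip m g = \int[rho]_x ip (Z x) g.

Definition tensor (R : realType) (H : completeNormedModType R)
    (ip : {dot H for idfun}) (u v : H) : H -> H :=
  fun f => ip f v *: u.

Definition is_covariance d (X : measurableType d) (R : realType)
    (H : completeNormedModType R) (ip : {dot H for idfun})
    (rho : probability X R) (phi : X -> H) (m : H) (M : H -> H) : Prop :=
  forall f, is_expectation ip rho
    (fun x => tensor ip (phi x - m) (phi x - m) f) (M f).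

Definition has_dim (R : realType) (H : lmodType R) (E : set H) (n : nat) :
    Prop :=
  exists v : 'I_n -> H,
    (forall c : 'I_n -> R, \sum_(i < n) c i *: v i = 0 -> forall i, c i = 0) /\
    E = range (fun c : 'I_n -> R => \sum_(i < n) c i *: v i).

(* [D] lists, in nonincreasing order and repeated according to multiplicity,
   the positive eigenvalues of the positive operator [M]; when there are only
   finitely many of them the sequence is continued by zeros. Indices start
   at 0. *)
Definition eigenvalue_seq (R : realType) (H : lmodType R) (M : H -> H)
    (D : nat -> R) : Prop :=
  [/\ nonincreasing_seq D,
      (forall j, 0 <= D j) &
      forall l : R, 0 < l ->
        exists2 n : nat, [set j | D j = l] #= `I_n
                       & has_dim [set f | M f = l *: f] n].

Definition gapped (R : realType) (r : nat) (D : nat -> R) : Prop :=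
  D r < D r.-1 /\ forall j, (j < r)%N -> 0 < D j - D j.+1.

(* The eigenvalues of the real matrix [A], with multiplicity, in nonincreasing
   order; for symmetric [A] there is exactly one such [s]. *)
Definition matrix_eigenvalues (R : realType) (n : nat) (A : 'M[R]_n)
    (s : seq R) : Prop :=
  sorted >=%R s /\ char_poly A = \prod_(a <- s) ('X - a%:P).

Definition centered_gram (X : Type) (R : realType)
    (H : completeNormedModType R) (ip : {dot H for idfun}) (phi : X -> H)
    (m : H) (N : nat) (x : 'I_N -> X) : 'M[R]_N :=
  \matrix_(i, j) ip (phi (x i) - m) (phi (x j) - m).

Definition normalized_gram (X : Type) (R : realType)
    (H : completeNormedModType R) (ip : {dot H for idfun}) (phi : X -> H)
    (m : H) (N : nat) (x : 'I_N -> X) : 'M[R]_N :=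
  N%:R^-1 *: centered_gram ip phi m x.

Definition iid_sample d d' (T : measurableType d) (X : measurableType d')
    (R : realType) (P : probability T R) (rho : probability X R) (N : nat)
    (x : 'I_N -> {RV P >-> X}) : Prop :=
  (forall i A, measurable A -> distribution P (x i) A = rho A) /\
  (forall (J : {set 'I_N}) (A : 'I_N -> set X),
     (forall i, measurable (A i)) ->
     P [set w | forall i, i \in J -> A i (x i w)] =
     (\prod_(i in J) P (x i @^-1` A i))%E).

Definition spectral_profile (R : realType) (r : nat) (D : nat -> R) :
    'rV[R]_r :=
  \row_(j < r) (D j / \sum_(i < r) D i).

(* The norm of the library on row vectors is the sup norm. *)
Definition norm2 (R : realType) (n : nat) (v : 'rV[R]_n) : R :=
  Num.sqrt (\sum_(j < n) v 0 j ^+ 2).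

Definition dist2 (R : realType) (n : nat) (u v : 'rV[R]_n) : R := norm2 (u - v).

(* Convergence in probability, along the filter [F], to the constant [z] for
   the distance [dist]. *)
Definition cvg_in_probability d (T : measurableType d) (R : realType)
    (P : probability T R) (I : Type) (F : set_system I) (V : Type)
    (dist : V -> V -> R) (Z : I -> T -> V) (z : V) : Prop :=
  forall eps : R, 0 < eps ->
    P [set w | eps < dist (Z i w) z] @[i --> F] --> 0%E.

(* Main.v *)
(* The covariance operator M is positive with finite trace, so on the orthogonal
   complement of finitely many eigenvectors the supremum l of its form is an
   eigenvalue: with T = M / l, the iterates T^j f converge to fixed vectors of T,
   and the trace condition prevents all these limits from vanishing. Hence
   finitely many eigenvectors e_j, for the largest eigenvalues D_j, leave a form
   bounded by a small eta.

   For a sample y_i of centered features put W_jl = (1/N) sum_i <y_i,e_j><y_i,e_l>.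
   By the law of large numbers W is close to diag(D), and by Courant-Fischer on
   the vectors (<y_i,e_j>)_i the Gram eigenvalues satisfy s_k >= D_k - o(1).
   Conversely sum_k s_k^2 = |W|^2 + Y, where the nonnegative variable
   Y = (1/N^2) sum_il <y_i,y_l>^2 - |W|^2 has mean at most a multiple of eta + 1/N,
   so that s_k^2 <= D_k^2 + o(1) by Markov's inequality. The profiles are
   continuous functions of the eigenvalues. *)
Require Import Defs.
From mathcomp Require Import all_boot all_order all_algebra sesquilinear.
From mathcomp Require Import all_classical all_reals all_analysis.
From mathcomp Require Import measurable_realfun finmap ring lra.

Set Implicit Arguments.
Unset Strict Implicit.
Unset Printing Implicit Defensive.

Import Order.TTheory GRing.Theory Num.Theory numFieldNormedType.Exports.

Local Open Scope classical_set_scope.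
Local Open Scope ring_scope.

(** * Real symmetric matrices *)

(** The operator [M] is accessible only through the numbers [ip (M f) g], which are integrals over
    [rho]. Its symmetry, its linearity and its trace bound are read off from these integrals, and
    its eigenvectors come from an iteration that uses nothing else. Two random quantities have to be
    small: Y and the entries of W - diag(D). Once the entries are squared, both are nonnegative
    double sums over the sample, so a single weighted statistic, [discrepancy], controls them with
    one use of Markov's inequality. Its nonnegativity for every sample is what allows a first-moment
    bound, and the weight [C] sets the accuracy demanded of W. Convergence in probability evaluates
    [P] on sets defined by the spectra, and comparing these sets with an exceptional event requires
    them to be measurable. The spectra are only prescribed pointwise, so the measurability of each
    sorted eigenvalue is a separate task, solved with traces of powers. *)

Lemma mx11_row_sum (R : comPzRingType) n (u v : 'rV[R]_n) :
  (u *m v^T) 0 0 = \sum_i u 0 i * v 0 i.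
Proof. by rewrite mxE; apply: eq_bigr => i _; rewrite mxE. Qed.

Lemma row_sqnorm_ge0 (R : realDomainType) n (u : 'rV[R]_n) :
  0 <= (u *m u^T) 0 0.
Proof. by rewrite mx11_row_sum sumr_ge0 // => i _; rewrite -expr2 sqr_ge0. Qed.

Lemma row_sqnorm_eq0 (R : realDomainType) n (u : 'rV[R]_n) :
  ((u *m u^T) 0 0 == 0) = (u == 0).
Proof.
rewrite mx11_row_sum psumr_eq0; last by move=> i _; rewrite -expr2 sqr_ge0.
apply/allP/eqP => [h|-> i _]; last by rewrite mxE mulr0 eqxx.
apply/rowP => i; rewrite mxE.
by have /= := h i (mem_index_enum i); rewrite mulf_eq0 orbb => /eqP.
Qed.

(* The Householder reflection exchanging [v] and the first basis vector. *)
Lemma orthogonal_completion (R : rcfType) n (v : 'rV[R]_n.+1) :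
  v *m v^T = 1%:M ->
  exists2 Q : 'M[R]_n.+1, Q *m Q^T = 1%:M & row 0 Q = v.
Proof.
move=> vv; pose e : 'rV[R]_n.+1 := delta_mx 0 0; pose w := e - v.
have ee : e *m e^T = 1%:M.
  rewrite [LHS]mx11_scalar mx11_row_sum (bigD1 0) //= big1 ?addr0 ?mxE ?eqxx ?mulr1 //.
  by move=> i i0; rewrite !mxE (negbTE i0) andbF mulr0.
have [v_e|v_e] := eqVneq v e.
  by exists 1%:M; rewrite ?trmx1 ?mulmx1 // v_e row1.
have w0 : (w *m w^T) 0 0 != 0 by rewrite row_sqnorm_eq0 subr_eq0 eq_sym.
set c := (w *m w^T) 0 0 in w0.
have cE : w *m w^T = c%:M by rewrite [LHS]mx11_scalar.
pose Q : 'M[R]_n.+1 := 1%:M - (2 / c) *: (w^T *m w).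
have QT : Q^T = Q by rewrite /Q linearB /= linearZ /= trmx1 trmx_mul trmxK.
have Qe : e *m Q = v.
  have ev : e *m v^T = v *m e^T.
    rewrite [LHS]mx11_scalar [RHS]mx11_scalar !mx11_row_sum; congr (_%:M).
    by apply: eq_bigr => i _; rewrite mulrC.
  have cd : c%:M = 2 *: (e *m w^T) :> 'M[R]_1.
    rewrite -cE /w linearB /= mulmxBl !mulmxBr ee vv -ev.
    set q := e *m v^T; clearbody q.
    by rewrite scaler_nat mulr2n [- (q - _)]opprB.
  (* Since [e] and [v] have equal length, <e, w> = |w|^2 / 2, so the reflection along [w] sends [e]
     to e - w = v. *)
  have ew : e *m w^T = (c / 2)%:M.
    by rewrite mulrC -scale_scalar_mx cd scalerA mulVf ?scale1r ?pnatr_eq0.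
  rewrite /Q mulmxBr mulmx1 -scalemxAr mulmxA ew mul_scalar_mx scalerA.
  have -> : 2 / c * (c / 2) = 1 by field.
  by rewrite scale1r /w opprB addrC subrK.
exists Q; last by rewrite rowE Qe.
rewrite QT /Q; set X := _ *: _.
have XX : X *m X = X + X.
  rewrite /X -scalemxAl -scalemxAr.
  have -> : w^T *m w *m (w^T *m w) = c *: (w^T *m w).
    by rewrite mulmxA -(mulmxA w^T) cE mul_mx_scalar -scalemxAl.
  by rewrite !scalerA -scalerDl; congr (_ *: _); field.
have XB : X - (X + X) = - X by rewrite opprD addrA subrr add0r.
by rewrite mulmxBl mul1mx mulmxBr mulmx1 XX XB opprK subrK.
Qed.

Lemma char_poly_orthogonal_conj (F : fieldType) n (A Q : 'M[F]_n) :
  Q *m Q^T = 1%:M -> char_poly (Q *m A *m Q^T) = char_poly A.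
Proof.
move=> QQ; rewrite /char_poly.
have QQp : map_mx polyC Q *m (map_mx polyC Q)^T = 1%:M.
  by rewrite map_trmx -map_mxM QQ map_mx1.
have -> : char_poly_mx (Q *m A *m Q^T) =
    map_mx polyC Q *m char_poly_mx A *m (map_mx polyC Q)^T.
  rewrite /char_poly_mx mulmxBr mulmxBl mul_mx_scalar -scalemxAl QQp scalemx1.
  by rewrite !map_mxM map_trmx.
rewrite !det_mulmx mulrAC -det_mulmx QQp det1 mul1r //.
Qed.

Lemma char_poly_lower_block (F : fieldType) n (a : F) (B : 'M[F]_n) :
  char_poly (block_mx (a%:M : 'M[F]_1) 0 0 B) = ('X - a%:P) * char_poly B.
Proof.
rewrite /char_poly char_block_diag_mx det_ublock; congr (_ * _).
by rewrite det_mx11 !mxE eqxx !mulr1n.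
Qed.

(* Deflation: a root of the characteristic polynomial yields a unit eigenvector,
   which an orthogonal change of basis splits off. *)
Lemma symmetric_diagonalization (R : rcfType) n (A : 'M[R]_n) (s : seq R) :
  A^T = A -> char_poly A = \prod_(a <- s) ('X - a%:P) ->
  exists2 Q : 'M[R]_n, Q *m Q^T = 1%:M &
    A = Q^T *m diag_mx (\row_i s`_i) *m Q.
Proof.
elim: n A s => [|n IH] A s symA chA.
  by exists 1%:M; [rewrite trmx1 mulmx1|apply/matrixP => -[]].
case: s chA => [|a s] chA.
  by have := size_char_poly A; rewrite chA big_nil size_poly1.
have /eigenvalueP[u uA u0] : eigenvalue A a.
  by rewrite eigenvalue_root_char chA big_cons rootM root_XsubC eqxx.
have [v vA vv] : exists2 v : 'rV[R]_n.+1, v *m A = a *: v & v *m v^T = 1%:M.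
  have p : 0 < (u *m u^T) 0 0.
    by rewrite lt_neqAle row_sqnorm_ge0 andbT eq_sym row_sqnorm_eq0.
  exists ((Num.sqrt ((u *m u^T) 0 0))^-1 *: u).
    by rewrite -scalemxAl uA scalerA mulrC -scalerA.
  rewrite [LHS]mx11_scalar linearZ /= -scalemxAl -scalemxAr scalerA mxE -invfM -expr2.
  by rewrite sqr_sqrtr ?ltW // mulVf ?gt_eqF.
have [H HH H0] := orthogonal_completion vv.
have HTH : H^T *m H = 1%:M by exact: mulmx1C.
have [B hB] : exists B, B = H *m A *m H^T by eexists.
have symB : B^T = B by rewrite hB !trmx_mul trmxK symA mulmxA.
have B0 : row 0 B = a *: delta_mx 0 0.
  by rewrite hB !row_mul H0 vA -scalemxAl -H0 -row_mul HH row1.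
pose B' : 'M[R]_n := drsubmx (B : 'M[R]_(1 + n)).
have BE : B = block_mx (a%:M : 'M[R]_1) 0 0 B' :> 'M[R]_(1 + n).
  rewrite -[LHS](@submxK R 1 n 1 n); congr block_mx.
  - apply/matrixP => i j; rewrite !ord1 !mxE /=.
    have /rowP/(_ 0) := B0; rewrite !mxE eqxx mulr1 /= mulr1n => <-.
    by congr (B _ _); apply: val_inj.
  - apply/matrixP => i j; rewrite !ord1 !mxE /=.
    have /rowP/(_ (rshift 1 j)) := B0; rewrite !mxE /= mulr0 => <-.
    by congr (B _ _); apply: val_inj.
  - apply/matrixP => i j; rewrite !ord1 !mxE /=.
    have /rowP/(_ (rshift 1 i)) := B0; rewrite !mxE /= mulr0 => <-.
    by rewrite -{1}symB mxE; congr (B _ _); apply: val_inj.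
have chB : char_poly B' = \prod_(b <- s) ('X - b%:P).
  apply: (mulfI (negbT (polyXsubC_eq0 a))).
  rewrite -char_poly_lower_block -BE hB char_poly_orthogonal_conj // chA big_cons.
  by [].
have symB' : B'^T = B' by rewrite /B' trmx_drsub symB.
have [Q QQ B'E] := IH B' s symB' chB.
pose Q1 : 'M[R]_(1 + n) := block_mx (1%:M : 'M[R]_1) 0 0 Q.
have Q1Q1 : Q1 *m Q1^T = 1%:M.
  rewrite /Q1 tr_block_mx mulmx_block !(mulmx0,mul0mx,trmx0,trmx1,addr0,add0r) QQ mulmx1.
  by rewrite -scalar_mx_block.
exists (Q1 *m H : 'M[R]_n.+1).
  by rewrite trmx_mul mulmxA -(mulmxA Q1) HH mulmx1 Q1Q1.
have -> : A = H^T *m B *m H.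
  by rewrite hB !mulmxA HTH mul1mx -mulmxA HTH mulmx1.
have diagE : diag_mx (\row_(i < 1 + n) (a :: s)`_i) =
    block_mx (a%:M : 'M[R]_1) 0 0 (diag_mx (\row_i s`_i)).
  rewrite -[LHS](@submxK R 1 n 1 n).
  by congr block_mx; apply/matrixP => i j; rewrite ?ord1 !mxE //=.
have BQ : (B : 'M[R]_(1 + n)) = Q1^T *m diag_mx (\row_i (a :: s)`_i) *m Q1.
  rewrite BE B'E diagE /Q1 tr_block_mx !mulmx_block.
  rewrite !(mulmx0,mul0mx,trmx0,trmx1,addr0,add0r).
  by rewrite mul1mx mulmx1.
by rewrite trmx_mul BQ !mulmxA.
Qed.

Section SymmetricSpectrum.
Variables (R : rcfType) (n : nat) (A : 'M[R]_n) (s : seq R).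
Hypothesis symA : A^T = A.
Hypothesis charA : char_poly A = \prod_(a <- s) ('X - a%:P).

Lemma size_char_roots : size s = n.
Proof. by have := size_char_poly A; rewrite charA size_prod_XsubC => -[]. Qed.

(** The square gives the Frobenius norm; arbitrary powers serve later to extract the eigenvalues as
    measurable functions of the matrix. *)
Lemma trace_power m : \tr (A ^+ m) = \sum_(i < n) s`_i ^+ m.
Proof.
have [Q QQ AE] := symmetric_diagonalization symA charA.
have Am : A ^+ m = Q^T *m diag_mx (\row_i (s`_i ^+ m)) *m Q.
  elim: m => [|m IHm].
    rewrite expr0 (_ : diag_mx _ = 1%:M) ?mulmx1 ?(mulmx1C QQ) //.
    by apply/matrixP => i j; rewrite !mxE expr0.
  rewrite exprS IHm -[_ * _]/(_ *m _) {1}AE !mulmxA -(mulmxA _ Q) QQ mulmx1.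
  rewrite -(mulmxA Q^T) mulmx_diag; congr (_ *m diag_mx _ *m _).
  by apply/rowP => i; rewrite !mxE exprS.
rewrite Am -mulmxA mxtrace_mulC -mulmxA QQ mulmx1 mxtrace_diag.
by apply: eq_bigr => i _; rewrite mxE.
Qed.

Lemma sum_sqr_eigenvalues :
  \sum_(i < n) s`_i ^+ 2 = \sum_(i < n) \sum_(j < n) A i j ^+ 2.
Proof.
rewrite -trace_power; apply: eq_bigr => i _.
rewrite expr2 -[A * A]/(A *m A) mxE; apply: eq_bigr => j _.
by rewrite expr2 -{2}symA mxE.
Qed.

Lemma eigenvalues_ge0 i :
  (forall u : 'rV[R]_n, 0 <= (u *m A *m u^T) 0 0) -> 0 <= s`_i.
Proof.
move=> psd; have [i_n|n_i] := ltnP i n; last first.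
  by rewrite nth_default // size_char_roots.
have [Q QQ AE] := symmetric_diagonalization symA charA.
have := psd (delta_mx 0 (Ordinal i_n) *m Q).
rewrite AE trmx_mul !mulmxA -(mulmxA _ Q) QQ mulmx1 -(mulmxA _ Q) QQ mulmx1.
rewrite mx11_row_sum (bigD1 (Ordinal i_n)) //= big1 ?addr0 => [|j /negbTE jn].
  by rewrite mul_mx_diag !mxE !eqxx /= mul1r mulr1.
by rewrite !mxE jn andbF mulr0.
Qed.

(* A dimension count: the span of the [k.+1] rows of [U] contains a nonzero
   vector orthogonal to the first [k] eigenvectors. *)
Lemma eigenvalue_lower_bound k (U : 'M[R]_(k.+1, n)) (b : R) :
  sorted >=%R s -> (k < n)%N ->
  (forall c : 'rV[R]_k.+1, c != 0 -> c *m U != 0 /\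
     b * (c *m U *m (c *m U)^T) 0 0 <= (c *m U *m A *m (c *m U)^T) 0 0) ->
  b <= s`_k.
Proof.
move=> s_sorted kn hU.
have [Q QQ AE] := symmetric_diagonalization symA charA.
pose W := U *m Q^T.
pose Wk : 'M[R]_(k.+1, k) := \matrix_(i, j) W i (widen_ord (ltnW kn) j).
have [c c0 cW] : exists2 c : 'rV[R]_k.+1, c != 0 & c *m Wk = 0.
  have : kermx Wk != 0.
    rewrite -mxrank_eq0 mxrank_ker -lt0n subn_gt0 ltnS; exact: rank_leq_col.
  case/rowV0Pn => c cker c0; exists c => //; exact/sub_kermxP.
have [cU0 bU] := hU c c0.
pose y := c *m U *m Q^T.
have yQ : c *m U = y *m Q by rewrite /y -mulmxA (mulmx1C QQ) mulmx1.
have y_small (i : 'I_n) : (i < k)%N -> y 0 i = 0.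
  move=> ik; have /rowP/(_ (Ordinal ik)) := cW; rewrite /y -mulmxA -/W; clearbody W.
  rewrite [RHS]mxE => <-; rewrite !mxE.
  by apply: eq_bigr => j _; rewrite mxE; congr (_ * W _ _); exact: val_inj.
have norm_y : (c *m U *m (c *m U)^T) 0 0 = \sum_i y 0 i ^+ 2.
  rewrite yQ trmx_mul mulmxA -(mulmxA y) QQ mulmx1 mx11_row_sum.
  by apply: eq_bigr => i _; rewrite expr2.
have form_y : (c *m U *m A *m (c *m U)^T) 0 0 = \sum_(i < n) s`_i * y 0 i ^+ 2.
  rewrite yQ AE trmx_mul !mulmxA -(mulmxA y) QQ mulmx1 -(mulmxA _ Q) QQ mulmx1.
  rewrite mx11_row_sum; apply: eq_bigr => i _.
  by rewrite mul_mx_diag !mxE; ring.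
have norm_gt0 : 0 < \sum_i y 0 i ^+ 2.
  by rewrite -norm_y lt_neqAle row_sqnorm_ge0 eq_sym row_sqnorm_eq0 cU0.
rewrite -(ler_pM2r norm_gt0); rewrite norm_y form_y in bU.
apply: le_trans bU _; rewrite mulr_sumr; apply: ler_sum => i _.
have [ik|ki] := ltnP i k; first by rewrite y_small // expr0n !mulr0.
apply: ler_wpM2r; first exact: sqr_ge0.
by apply: (sorted_leq_nth (rev_trans le_trans) lexx) => //; rewrite inE size_char_roots.
Qed.

End SymmetricSpectrum.

(** * Inner products and positive contractions *)

Section InnerProduct.
Variables (R : realType) (H : completeNormedModType R) (ip : {dot H for idfun}).
Implicit Types (f g h : H) (a : R).

Lemma ipC f g : ip f g = ip g f.
Proof. by rewrite hermC expr0 mul1r. Qed.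

Lemma ipDl f g h : ip (f + g) h = ip f h + ip g h.
Proof. exact: linearDl. Qed.

Lemma ipBl f g h : ip (f - g) h = ip f h - ip g h.
Proof. exact: linearBl. Qed.

Lemma ipZl a f h : ip (a *: f) h = a * ip f h.
Proof. exact: linearZl_LR. Qed.

Lemma ip0l h : ip 0 h = 0.
Proof. exact: linear0l. Qed.

Lemma ip_suml I (r : seq I) (Q : pred I) (F : I -> H) h :
  ip (\sum_(i <- r | Q i) F i) h = \sum_(i <- r | Q i) ip (F i) h.
Proof. exact: linear_sumlz. Qed.

Lemma ipDr f g h : ip f (g + h) = ip f g + ip f h.
Proof. by rewrite ipC ipDl !(ipC f). Qed.

Lemma ipBr f g h : ip f (g - h) = ip f g - ip f h.
Proof. by rewrite ipC ipBl !(ipC f). Qed.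

Lemma ipZr a f h : ip f (a *: h) = a * ip f h.
Proof. by rewrite ipC ipZl (ipC f). Qed.

Lemma ip0r f : ip f 0 = 0.
Proof. by rewrite ipC ip0l. Qed.

Lemma ip_sumr I (r : seq I) (Q : pred I) (F : I -> H) f :
  ip f (\sum_(i <- r | Q i) F i) = \sum_(i <- r | Q i) ip f (F i).
Proof. by rewrite ipC ip_suml; apply: eq_bigr => i _; rewrite ipC. Qed.

Lemma ip_gt0 f : f != 0 -> 0 < ip f f.
Proof. exact: neq0_dnorm_gt0. Qed.

Lemma ip_ge0 f : 0 <= ip f f.
Proof. by have [->|/ip_gt0/ltW//] := eqVneq f 0; rewrite ip0l. Qed.

Lemma ip_eq0 f : ip f f = 0 -> f = 0.
Proof. by move=> f0; apply/eqP; apply: contra_eqT f0 => /ip_gt0; rewrite lt0r => /andP[]. Qed.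

Definition orthonormal_upto n (e : nat -> H) :=
  forall i j, (i < n)%N -> (j < n)%N -> ip (e i) (e j) = (i == j)%:R.

Lemma orthonormal_upto_sum n e (c : nat -> R) k :
  orthonormal_upto n e -> (k < n)%N ->
  ip (\sum_(i < n) c i *: e i) (e k) = c k.
Proof.
move=> eON kn; rewrite ip_suml (bigD1 (Ordinal kn)) //= big1 ?addr0.
  by rewrite ipZl eON // eqxx mulr1.
move=> i /negbTE ik; rewrite ipZl eON // (_ : (_ == _) = false) ?mulr0 //.
Qed.

Lemma residual_orthogonal n e f k : orthonormal_upto n e -> (k < n)%N ->
  ip (f - \sum_(i < n) ip f (e i) *: e i) (e k) = 0.
Proof.
by move=> eON kn; rewrite ipBl (orthonormal_upto_sum (fun i => ip f (e i))) // subrr.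
Qed.

(** Polarized Pythagoras: the span of the family and its complement contribute separately. Besides
    Bessel's inequality it is applied to distinct arguments such as [M f] and [f]. *)
Lemma bessel_residual n e f g : orthonormal_upto n e ->
  ip f g = \sum_(i < n) ip f (e i) * ip g (e i) +
    ip (f - \sum_(i < n) ip f (e i) *: e i) (g - \sum_(i < n) ip g (e i) *: e i).
Proof.
move=> eON; set p := \sum_(i < n) ip g (e i) *: e i.
set q := f - _.
have qp : ip q p = 0.
  by rewrite /p ip_sumr big1 // => i _; rewrite ipZr residual_orthogonal ?mulr0.
rewrite ipBr qp subr0 /q ipBl ip_suml addrC.
have -> : \sum_(i < n) ip f (e i) * ip g (e i) =
    \sum_(i < n) ip (ip f (e i) *: e i) g.
  by apply: eq_bigr => i _; rewrite ipZl (ipC g).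
by rewrite subrK.
Qed.

Lemma orthonormal_upto_rcons n e f :
  orthonormal_upto n e -> ip f f = 1 ->
  (forall i, (i < n)%N -> ip f (e i) = 0) ->
  orthonormal_upto n.+1 (fun i => if i == n then f else e i).
Proof.
move=> eON ff fe i j; rewrite !ltnS (leq_eqVlt i) (leq_eqVlt j).
case: (eqVneq i n) => [->|in_] /=; case: (eqVneq j n) => [->|jn] /=.
- by rewrite ff.
- by move=> _ jltn; rewrite fe.
- by move=> iltn _; rewrite ipC fe // (negbTE in_).
- exact: eON.
Qed.

Lemma sum_rcons n (F : H -> R) (e : nat -> H) f :
  \sum_(i < n.+1) F (if i == n :> nat then f else e i) =
  \sum_(i < n) F (e i) + F f.
Proof.
rewrite big_ord_recr /= eqxx; congr (_ + _).
by apply: eq_bigr => i _; rewrite ltn_eqF.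
Qed.

Lemma ip_sqnormB f g : ip (f - g) (f - g) = ip f f - 2 * ip f g + ip g g.
Proof. by rewrite ipBl !ipBr (ipC g f); ring. Qed.

End InnerProduct.

Section PositiveOperator.
Variables (R : realType) (H : completeNormedModType R) (ip : {dot H for idfun}).
Hypothesis ip_norm : norm_from_inner ip.
Implicit Types (f g h : H) (a : R).

(** The form of [T] is positive only on [V] and may be degenerate there; the bound is the sign of
    the discriminant of t -> <T(tf + g), tf + g>. *)
Lemma cauchy_schwarz_form (T : H -> H) (V : H -> Prop) :
  (forall f g, ip (T f) g = ip f (T g)) ->
  (forall a f g, T (a *: f + g) = a *: T f + T g) ->
  (forall a f g, V f -> V g -> V (a *: f + g)) ->
  (forall f, V f -> 0 <= ip (T f) f) ->
  forall f g, V f -> V g -> ip (T f) g ^+ 2 <= ip (T f) f * ip (T g) g.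
Proof.
move=> symT linT linV posT f g Vf Vg.
set a := ip (T f) f; set b := ip (T f) g; set c := ip (T g) g.
have a0 : 0 <= a by exact: posT.
have c0 : 0 <= c by exact: posT.
have P t : 0 <= t ^+ 2 * a + 2 * t * b + c.
  have := posT _ (linV t _ _ Vf Vg).
  rewrite linT !ipDl !ipDr !ipZl !ipZr -/a -/b -/c (symT g) (ipC _ g) -/b.
  by congr (0 <= _); ring.
have [a_eq0|a_neq0] := eqVneq a 0.
  have [->|b0] := eqVneq b 0; first by rewrite expr0n mulr_ge0.
  (* For a = 0 the polynomial is affine with slope 2b, and this argument would give it the value
     -1. *)
  have := P (- (c + 1) / (2 * b)); rewrite a_eq0 mulr0 add0r.
  have -> : 2 * (- (c + 1) / (2 * b)) * b + c = -1 by field.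
  by rewrite oppr_ge0 ler10.
have := P (- b / a).
have -> : (- b / a) ^+ 2 * a + 2 * (- b / a) * b + c = (a * c - b ^+ 2) / a by field.
by rewrite pmulr_lge0 ?invr_gt0 ?lt_neqAle 1?eq_sym ?a_neq0 // subr_ge0.
Qed.

Lemma cauchy_schwarz f g : ip f g ^+ 2 <= ip f f * ip g g.
Proof.
by apply: (@cauchy_schwarz_form id (fun=> True)) => // h _; exact: ip_ge0.
Qed.

Lemma norm_ip_le f g : `|ip f g| <= `|f| * `|g|.
Proof.
rewrite -(ler_pXn2r (ltn0Sn 1)) ?nnegrE ?mulr_ge0 //.
by rewrite exprMn !ip_norm real_normK ?num_real ?cauchy_schwarz.
Qed.

Lemma cvg_ipl (u : nat -> H) f h :
  u @ \oo --> f -> ip (u n) h @[n --> \oo] --> ip f h.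
Proof.
move=> uf; apply/cvgrPdist_le => e e0.
have e1 : 0 < e / (`|h| + 1) by rewrite divr_gt0 // ltr_pwDr.
near=> n; rewrite -ipBl; apply: le_trans (norm_ip_le _ _) _.
have un : `|f - u n| <= e / (`|h| + 1).
  by near: n; move/cvgrPdist_le: uf; apply.
apply: le_trans (ler_wpM2r (normr_ge0 h) un) _.
rewrite mulrAC ler_pdivrMr ?ltr_pwDr // mulrDr mulr1 lerDl.
exact: ltW.
Unshelve. all: by end_near. Qed.

Section Contraction.
Variables (T : H -> H) (V : H -> Prop).
Hypothesis symT : forall f g, ip (T f) g = ip f (T g).
Hypothesis linT : forall a f g, T (a *: f + g) = a *: T f + T g.
Hypothesis linV : forall a f g, V f -> V g -> V (a *: f + g).
Hypothesis TV : forall f, V f -> V (T f).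
Hypothesis closedV : forall (u : nat -> H) f,
  (forall n, V (u n)) -> u @ \oo --> f -> V f.
Hypothesis posT : forall f, V f -> 0 <= ip (T f) f.
Hypothesis contractT : forall f, V f -> ip (T f) f <= ip f f.

(** Cauchy-Schwarz for the form of [T], applied to f and T f, reads |T f|^4 <= <T f, f> <T^2 f, T
    f>; the contraction bound at T f then cancels one factor |T f|^2. *)
Lemma contraction_sqnorm f : V f -> ip (T f) (T f) <= ip (T f) f.
Proof.
move=> Vf; have [->|T0] := eqVneq (ip (T f) (T f)) 0; first exact: posT.
have p : 0 < ip (T f) (T f) by rewrite lt_neqAle eq_sym T0 ip_ge0.
rewrite -(ler_pM2r p) -expr2.
apply: le_trans (cauchy_schwarz_form symT linT linV posT Vf (TV Vf)) _.
by apply: ler_wpM2l; [exact: posT|exact/contractT/TV].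
Qed.

Lemma contraction_norm f : V f -> `|T f| <= `|f|.
Proof.
move=> Vf; rewrite -(ler_pXn2r (ltn0Sn 1)) ?nnegrE // !ip_norm.
exact: le_trans (contraction_sqnorm Vf) (contractT Vf).
Qed.

Lemma iter_invariant f j : V f -> V (iter j T f).
Proof. by move=> Vf; elim: j => //= j; exact: TV. Qed.

Lemma ip_iter f i j : ip (iter i T f) (iter j T f) = ip (iter (i + j) T f) f.
Proof.
elim: j i => [|j IHj] i; first by rewrite addn0.
by rewrite /= -symT -iterS IHj addnS.
Qed.

(** Even and odd indices alternate: for k = 2j the step is the contraction bound at T^j f, for k =
    2j + 1 it is [contraction_sqnorm] at the same vector. *)
Lemma ip_iter_nonincreasing f : V f ->
  nonincreasing_seq (fun k => ip (iter k T f) f).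
Proof.
move=> Vf; apply/nonincreasing_seqP => k.
rewrite -(odd_double_half k) -addnn; set j := k./2.
case: (odd k); rewrite ?add0n ?add1n.
  by rewrite -addSn -addnS -!ip_iter; exact/contraction_sqnorm/iter_invariant.
by rewrite -addSn -!ip_iter; exact/contractT/iter_invariant.
Qed.

(* [<T^k f, f>] decreases, hence [|T^i f - T^j f|^2] tends to 0. *)
Lemma iter_cvg_fixpoint f : V f ->
  exists g, [/\ (fun j => iter j T f) @ \oo --> g, V g & T g = g].
Proof.
move=> Vf; pose a k := ip (iter k T f) f.
have aE i j : ip (iter i T f) (iter j T f) = a (i + j)%N by exact: ip_iter.
have a_ge0 k : 0 <= a k.
  rewrite /a -(odd_double_half k) -addnn; set j := k./2.
  case: (odd k); rewrite ?add0n ?add1n -?addSn -ip_iter ?ip_ge0 //.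
  exact/posT/iter_invariant.
have a_dec := ip_iter_nonincreasing Vf.
have a_cvg : cvgn a.
  by apply: nonincreasing_is_cvgn => //; exists 0 => _ [k _ <-].
have [l al] : exists l : R, a @ \oo --> l by move/cvg_ex : a_cvg.
have a_ge k : l <= a k.
  by rewrite -(cvg_lim _ al) //; exact: nonincreasing_cvgn_ge.
have it_cvg : cvgn (fun j => iter j T f).
  apply/cauchy_cvgP/cauchy_exP => e e0.
  (* In |T^i f - T^j f|^2 = a_{2i} - 2 a_{i+j} + a_{2j} the outer terms exceed l by at most e^2 / 4
     each and the middle one is at least l, which leaves e^2 / 2. *)
  have e2 : 0 < e ^+ 2 / 4 by rewrite divr_gt0 ?exprn_gt0.
  have [N _ aN] : \forall n \near \oo, a n <= l + e ^+ 2 / 4.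
    have /cvgrPdist_le/(_ _ e2) := al; apply: filterS => n.
    by rewrite ler_norml => /andP[+ _]; lra.
  have itN i j : (N <= i)%N -> (N <= j)%N -> `|iter i T f - iter j T f| < e.
    move=> Ni Nj; rewrite -(ltr_pXn2r (ltn0Sn 1)) ?nnegrE // ?(ltW e0) //.
    rewrite ip_norm ip_sqnormB !aE.
    have := aN (i + i)%N; rewrite /= (leq_trans Ni (leq_addr _ _)) => /(_ isT).
    have := aN (j + j)%N; rewrite /= (leq_trans Nj (leq_addr _ _)) => /(_ isT).
    have := a_ge (i + j)%N.
    have : 0 < e ^+ 2 by rewrite exprn_gt0.
    lra.
  by exists (iter N T f); exists N => // n /= Nn; rewrite -ball_normE /=; exact: itN.
have [g itg] : exists g : H, (fun j => iter j T f) @ \oo --> g.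
  by move/cvg_ex : it_cvg.
exists g; split=> //; first by apply: closedV itg => n; exact: iter_invariant.
(* The limit is identified weakly: symmetry moves [T] onto the fixed vector [h], which replaces
   continuity of [T]. *)
suff E h : ip (T g) h = ip g h.
  by apply/eqP; rewrite -subr_eq0; apply/eqP/(ip_eq0 (ip := ip)); rewrite ipBl E subrr.
have c2 : ip (iter n.+1 T f) h @[n --> \oo] --> ip g h.
  by apply: cvg_ipl; rewrite (cvg_shiftS (fun n => iter n T f)).
have itE : (fun n => ip (iter n.+1 T f) h) = (fun n => ip (iter n T f) (T h)).
  by apply/funext => n; rewrite -symT.
rewrite itE in c2; rewrite symT.
by apply: (cvg_unique _ (cvg_ipl (h := T h) itg) c2); exact: Rhausdorff.
Qed.

End Contraction.
End PositiveOperator.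

(** * Compactness from the trace bound, and existence of a top eigenvector *)

Section CompactOperator.
Variables (R : realType) (H : completeNormedModType R) (ip : {dot H for idfun}).
Hypothesis ip_norm : norm_from_inner ip.
Variables (M : H -> H) (t : R).
Hypothesis symM : forall f g, ip (M f) g = ip f (M g).
Hypothesis linM : forall a f g, M (a *: f + g) = a *: M f + M g.
Hypothesis posM : forall f, 0 <= ip (M f) f.
Hypothesis traceM : forall n e, orthonormal_upto ip n e ->
  \sum_(i < n) ip (M (e i)) (e i) <= t.
Implicit Types (f g h : H) (a : R).

Lemma op_scale a f : M (a *: f) = a *: M f.
Proof.
have M0 : M 0 = 0.
  by have := linM (-1) 0 0; rewrite scaler0 addr0 scaleN1r addNr.
by rewrite -[a *: f]addr0 linM M0 addr0.
Qed.

Lemma op_form_scale a f : ip (M (a *: f)) (a *: f) = a ^+ 2 * ip (M f) f.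
Proof. by rewrite op_scale ipZl ipZr mulrA expr2. Qed.

Lemma normalize_unit f : f != 0 ->
  ip ((`|f|^-1) *: f) ((`|f|^-1) *: f) = 1.
Proof.
move=> f0; rewrite ipZl ipZr -ip_norm mulrA -expr2 exprVn mulVf //.
by rewrite expf_neq0 // normr_eq0.
Qed.

Lemma unit_norm f : ip f f = 1 -> `|f| = 1.
Proof.
move=> f1; apply: (pexpIrn (n := 2)) => //; rewrite ?nnegrE //.
by rewrite ip_norm f1 expr1n.
Qed.

Section InvariantSubspace.
Variable V : H -> Prop.
Hypothesis linV : forall a f g, V f -> V g -> V (a *: f + g).
Hypothesis MV : forall f, V f -> V (M f).
Hypothesis closedV : forall (u : nat -> H) f,
  (forall n, V (u n)) -> u @ \oo --> f -> V f.

Lemma subspace_zero f : V f -> V 0.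
Proof. by move=> Vf; have := linV (-1) Vf Vf; rewrite scaleN1r addNr. Qed.

Lemma subspace_scale a f : V f -> V (a *: f).
Proof.
by move=> Vf; rewrite -[a *: f]addr0; apply: linV => //; exact: subspace_zero Vf.
Qed.

Lemma subspace_comb f n (c : 'I_n -> R) (F : 'I_n -> H) : V f ->
  (forall i, V (F i)) -> V (\sum_(i < n) c i *: F i).
Proof.
move=> Vf VF; apply: (big_ind V); first exact: subspace_zero Vf.
  by move=> g h Vg Vh; rewrite -[g]scale1r; exact: linV.
by move=> i _; exact: subspace_scale.
Qed.

(* Trace class gives compactness: a finite orthonormal family that nearly
   exhausts the trace of [M] on [V] leaves a small form on its complement. *)
Lemma small_tail (eta : R) : 0 < eta ->
  exists q E, [/\ orthonormal_upto ip q E, forall i, (i < q)%N -> V (E i) &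
    forall g, V g -> (forall i, (i < q)%N -> ip g (E i) = 0) ->
      ip (M g) g <= eta * ip g g].
Proof.
move=> eta0.
pose S := [set y : R | exists q E, [/\ orthonormal_upto ip q E,
  forall i, (i < q)%N -> V (E i) & y = \sum_(i < q) ip (M (E i)) (E i)]].
have hS : has_sup S.
  split; first by exists 0, 0%N, (fun=> 0); split=> //; rewrite big_ord0.
  by exists t => _ [q [E [EON _ ->]]]; exact: traceM.
have [_ [q [E [EON VE ->]]] supE] := sup_adherent eta0 hS.
exists q, E; split=> // g Vg gE.
have [->|g0] := eqVneq g 0.
  by rewrite ip0r mulr_ge0 ?ip0l // ltW.
pose h := `|g|^-1 *: g.
have hE i : (i < q)%N -> ip h (E i) = 0 by move=> iq; rewrite ipZl gE ?mulr0.
have EhON := orthonormal_upto_rcons EON (normalize_unit g0) hE.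
have : ip (M h) h <= eta.
  have : \sum_(i < q) ip (M (E i)) (E i) + ip (M h) h <= sup S.
    rewrite -(sum_rcons q (fun f => ip (M f) f)); apply: ub_le_sup; first by case: hS.
    exists q.+1, (fun i => if i == q then h else E i); split=> // i.
    rewrite ltnS leq_eqVlt; case: eqVneq => [_ _|_ /=]; last exact: VE.
    exact: subspace_scale.
  lra.
rewrite op_form_scale exprVn ip_norm mulrC ler_pdivrMr //.
exact: ip_gt0.
Qed.

(** By contradiction: without an eigenvector for the supremum [l], the iterates of T = M / l tend to
    0 on all of [V]. A near-maximizer [f] is almost fixed by [T], so its j-th iterate keeps norm at
    least 3/4, while splitting [f] along the family of [small_tail] bounds that iterate by 1/8 +
    1/2. *)
Lemma top_eigenvector (b : R) : 0 <= b ->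
  (exists2 f, V f & b * ip f f < ip (M f) f) ->
  exists l g, [/\ b < l, V g, g != 0 & M g = l *: g].
Proof.
move=> b0 [f0 Vf0 bf0].
have f0_neq0 : f0 != 0.
  by apply: contraTneq bf0 => ->; rewrite !ip0r mulr0 ltxx.
pose S := [set ip (M f) f | f in [set f | V f /\ ip f f = 1]].
have hS : has_sup S.
  split.
    eexists; exists (`|f0|^-1 *: f0); last reflexivity.
    by split; [exact: subspace_scale|exact: normalize_unit].
  exists t => _ [f [Vf f1] <-].
  have fON : orthonormal_upto ip 1 (fun=> f).
    by move=> i j; rewrite !ltnS !leqn0 => /eqP -> /eqP ->.
  by have := traceM fON; rewrite big_ord1.
pose l := sup S.
have form_le f : V f -> ip (M f) f <= l * ip f f.
  move=> Vf; have [->|f_neq0] := eqVneq f 0; first by rewrite !ip0r mulr0.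
  have : ip (M (`|f|^-1 *: f)) (`|f|^-1 *: f) <= l.
    apply: ub_le_sup; first by case: hS.
    by exists (`|f|^-1 *: f) => //; split; [exact: subspace_scale|exact: normalize_unit].
  by rewrite op_form_scale exprVn ip_norm mulrC ler_pdivrMr // ip_gt0.
have bl : b < l.
  by rewrite -(ltr_pM2r (ip_gt0 ip f0_neq0)); exact: lt_le_trans bf0 (form_le _ Vf0).
have l0 : 0 < l by exact: le_lt_trans bl.
pose T f := l^-1 *: M f.
have symT f g : ip (T f) g = ip f (T g) by rewrite /T ipZl ipZr symM.
have linT a f g : T (a *: f + g) = a *: T f + T g.
  by rewrite /T linM scalerDr !scalerA (mulrC a).
have TV f : V f -> V (T f) by move=> Vf; apply: subspace_scale; exact: MV.
have TE f : ip (T f) f = ip (M f) f / l by rewrite /T ipZl mulrC.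
have posT f : V f -> 0 <= ip (T f) f by rewrite TE divr_ge0 // ltW.
have contractT f : V f -> ip (T f) f <= ip f f.
  by move=> Vf; rewrite TE ler_pdivrMr // mulrC form_le.
apply: contrapT => no_eigen.
have iter0 f : V f -> (fun j => iter j T f) @ \oo --> (0 : H).
  move=> Vf.
  have [g [itg Vg Tg]] := iter_cvg_fixpoint ip_norm symT linT linV TV closedV posT contractT Vf.
  have [g0|g_neq0] := eqVneq g 0; first by rewrite -g0.
  case: no_eigen; exists l, g; split=> //.
  by rewrite -[in RHS]Tg /T scalerA mulfV ?scale1r // gt_eqF.
have lin_iter j a f g : iter j T (a *: f + g) = a *: iter j T f + iter j T g.
  by elim: j => //= j ->; rewrite linT.
have iter_le j f : V f -> `|iter j T f| <= `|f|.
  move=> Vf; elim: j => [//|j IHj]; rewrite iterS; apply: le_trans IHj.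
  exact: (contraction_norm ip_norm symT linT linV TV posT contractT (iter_invariant TV j Vf)).
(* On the complement of [E] the form of [T] is then at most 1/4, hence |T g| <= 1/2 for |g| <= 1. *)
have l4 : 0 < l / 4 by rewrite divr_gt0.
have [q [E [EON VE E_tail]]] := small_tail l4.
(* The [q] coefficients of [f] have size at most 1, so the iterates of its component along [E] add
   up to at most 1/8; [q.+1] covers q = 0. *)
have d0 : 0 < (8 * q.+1%:R)^-1 :> R by rewrite invr_gt0 mulr_gt0.
have iterE_small : \forall j \near \oo,
    forall i : 'I_q, `|iter j T (E i)| <= (8 * q.+1%:R)^-1.
  apply: filter_forall => i.
  have /cvgrPdist_le/(_ _ d0) := iter0 _ (VE i (ltn_ord i)).
  by apply: filterS => n; rewrite sub0r normrN.
have [j [j0 Ej]] := filter_ex (filterI (nbhs_infty_gt 0) iterE_small).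
(* The exponent [j] is fixed before [f]. Then |T f - f|^2 <= 1 - <T f, f> <= eps = (1/(4j))^2, so
   [j] steps move [f] by at most 1/4. *)
pose eps : R := (16 * j%:R ^+ 2)^-1.
have j0R : 0 < j%:R :> R by rewrite ltr0n.
have eps0 : 0 < eps by rewrite invr_gt0 mulr_gt0 ?exprn_gt0.
have [_ [f [Vf f1] <-] f_max] := sup_adherent (mulr_gt0 l0 eps0) hS.
have Tf_near : `|T f - f| <= (4 * j%:R)^-1.
  rewrite -(ler_pXn2r (ltn0Sn 1)) ?nnegrE ?invr_ge0 ?mulr_ge0 // ip_norm.
  rewrite ip_sqnormB f1.
  have := contraction_sqnorm symT linT linV TV posT contractT Vf.
  have : 1 - eps <= ip (T f) f.
    by rewrite TE ler_pdivlMr // mulrBl mul1r mulrC ltW.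
  have -> : (4 * j%:R)^-1 ^+ 2 = eps by rewrite exprVn exprMn -natrX.
  lra.
have far : 3 / 4 <= `|iter j T f|.
  have step i : `|iter i T f - f| <= i%:R * `|T f - f|.
    elim: i => [|i IHi]; first by rewrite subrr normr0 mul0r.
    rewrite iterSr -(subrKA (iter i T f)) mulrSr mulrDl mul1r addrC.
    apply: le_trans (ler_normD _ _) _; rewrite lerD //.
    have -> : iter i T (T f) - iter i T f = iter i T (T f - f).
      by rewrite [T f - f]addrC -[- f]scaleN1r lin_iter scaleN1r addrC.
    apply: iter_le; rewrite addrC -[- f]scaleN1r.
    by apply: linV => //; exact: TV.
  have : `|iter j T f - f| <= 1 / 4.
    apply: le_trans (step j) _; apply: le_trans (ler_wpM2l (ltW j0R) Tf_near) _.
    by rewrite invfM mulrCA mulfV ?gt_eqF // mulr1 mul1r.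
  have := lerB_dist f (f - iter j T f); rewrite subKr distrC (unit_norm f1).
  lra.
pose p := \sum_(i < q) ip f (E i) *: E i.
have Vp : V p by apply: subspace_comb Vf _ => i; exact: VE.
have Vg : V (f - p) by rewrite addrC -scaleN1r; exact: linV.
have pythagoras := bessel_residual f f EON.
have sq_ge0 i : 0 <= ip f (E i) * ip f (E i) by rewrite -expr2 sqr_ge0.
have coef_le i : (i < q)%N -> `|ip f (E i)| <= 1.
  move=> iq; apply: le_trans (norm_ip_le ip_norm _ _) _.
  by rewrite !unit_norm ?mul1r // EON ?eqxx.
have g1 : ip (f - p) (f - p) <= 1.
  by rewrite -f1 [leRHS]pythagoras lerDr sumr_ge0.
have Tg : `|T (f - p)| <= 1 / 2.
  rewrite -(ler_pXn2r (ltn0Sn 1)) ?nnegrE // ip_norm.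
  apply: le_trans (contraction_sqnorm symT linT linV TV posT contractT Vg) _.
  rewrite TE ler_pdivrMr //.
  have gE i : (i < q)%N -> ip (f - p) (E i) = 0.
    exact: residual_orthogonal.
  apply: le_trans (E_tail _ Vg gE) _.
  have : l * ip (f - p) (f - p) <= l * 1 by rewrite ler_pM2l.
  lra.
have iterD x y : iter j T (x + y) = iter j T x + iter j T y.
  by rewrite -[x in LHS]scale1r lin_iter scale1r.
have iter_p : iter j T p = \sum_(i < q) ip f (E i) *: iter j T (E i).
  have iter_0 : iter j T 0 = 0.
    by have := lin_iter j (-1) 0 0; rewrite scaler0 addr0 scaleN1r addNr.
  rewrite /p (big_morph _ iterD iter_0); apply: eq_bigr => i _.
  by rewrite -[in LHS](addr0 (_ *: _)) lin_iter iter_0 addr0.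
have iter_p_le : `|iter j T p| <= 1 / 8.
  rewrite iter_p; apply: le_trans (ler_norm_sum _ _ _) _.
  have : \sum_(i < q) `|ip f (E i) *: iter j T (E i)| <=
      \sum_(i < q) (8 * q.+1%:R)^-1.
    apply: ler_sum => i _; rewrite normrZ -[leRHS]mul1r.
    by apply: ler_pM => //; exact: coef_le.
  move/le_trans; apply; rewrite sumr_const card_ord -[_ *+ q]mulr_natr.
  rewrite mulrC ler_pdivrMr ?mulr_gt0 // mulrA mulfVK ?pnatr_eq0 // mul1r.
  by rewrite ler_nat.
have iter_g_le : `|iter j T (f - p)| <= 1 / 2.
  (* As j > 0, one application of [T] brings the tail to norm at most 1/2, and the others do not
     increase it. *)
  rewrite -(prednK j0) iterSr; apply: le_trans Tg; exact/iter_le/TV.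
have fE : iter j T f = iter j T p + iter j T (f - p).
  by rewrite -iterD subrKC.
have := ler_normD (iter j T p) (iter j T (f - p)); rewrite -fE.
lra.
Qed.

End InvariantSubspace.
End CompactOperator.

Lemma card_uniq_seq (s : seq nat) : uniq s -> ([set` s] #= `I_(size s))%card.
Proof.
move=> us; have -> : [set` s] = [set` [fset x in s]%fset].
  by apply/seteqP; split=> x /=; rewrite in_fset.
by apply/card_eq_fsetP; rewrite card_fseq undup_id.
Qed.

Section Dimension.
Variables (R : realType) (H : completeNormedModType R) (ip : {dot H for idfun}).
Variables (E : set H) (p : nat).
Hypothesis dimE : has_dim E p.

Lemma mx_kernel_row q (B : 'M[R]_(p, q)) : (q < p)%N ->
  exists2 y : 'rV[R]_p, y != 0 & y *m B = 0.
Proof.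
move=> qp; have : kermx B != 0.
  rewrite -mxrank_eq0 mxrank_ker -lt0n subn_gt0.
  exact: leq_ltn_trans (rank_leq_col _) qp.
by case/rowV0Pn => y /sub_kermxP yB y0; exists y.
Qed.

(** Orthogonality imposes q linear conditions on p > q coefficients. This is how an eigenspace
    supplies one more eigenvector. *)
Lemma has_dim_orthogonal_vector q (v : nat -> H) : (q < p)%N ->
  exists f, [/\ E f, f != 0 & forall i, (i < q)%N -> ip f (v i) = 0].
Proof.
case: dimE => b [b_free EE] qp.
have [y y0 yB] := mx_kernel_row (\matrix_(i < p, a < q) ip (b i) (v a)) qp.
exists (\sum_i y 0 i *: b i); split.
- by rewrite EE; exists (y 0).
- apply: contra_neq y0 => /b_free y0; apply/rowP => i; rewrite mxE; exact: y0.
- move=> i iq; have /rowP/(_ (Ordinal iq)) := yB; rewrite !mxE => yBi.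
  rewrite -[RHS]yBi ip_suml; apply: eq_bigr => j _.
  by rewrite ipZl mxE.
Qed.
End Dimension.

Lemma orthonormal_le_dim (R : realType) (H : completeNormedModType R)
    (ip : {dot H for idfun}) (E : set H) p q e : has_dim E p ->
  orthonormal_upto ip q e -> (forall i, (i < q)%N -> E (e i)) -> (q <= p)%N.
Proof.
move=> [b [_ EE]] eON Ee; rewrite leqNgt; apply/negP => pq.
have /choice[c cE] : forall a : 'I_q, exists c : 'I_p -> R,
    e a = \sum_i c i *: b i.
  by move=> a; have := Ee a (ltn_ord a); rewrite EE => -[c _ <-]; exists c.
have [y y0 yC] := mx_kernel_row (\matrix_(a < q, i < p) c a i) pq.
have y_sum : \sum_(a < q) y 0 a *: e a = 0.
  under eq_bigr do rewrite cE scaler_sumr.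
  rewrite exchange_big /= big1 // => i _.
  under eq_bigr do rewrite scalerA.
  rewrite -scaler_suml; have /rowP/(_ i) := yC; rewrite !mxE => yCi.
  rewrite (_ : \sum_a _ = 0) ?scale0r // -[RHS]yCi.
  by apply: eq_bigr => a _; rewrite mxE.
case/eqP: y0; apply/rowP => a; rewrite mxE.
(* [orthonormal_upto_sum] takes coefficients indexed by [nat]; [z] extends [y] by 0. *)
pose z k := if insub k is Some k' then y 0 (k' : 'I_q) else 0.
have zE (k : 'I_q) : z k = y 0 k by rewrite /z valK.
have := orthonormal_upto_sum z eON (ltn_ord a).
rewrite zE => <-; under eq_bigr do rewrite zE.
by rewrite y_sum ip0l.
Qed.

(** * Orthonormal eigenvectors along the eigenvalue sequence *)

Section Eigenbasis.
Variables (R : realType) (H : completeNormedModType R) (ip : {dot H for idfun}).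
Hypothesis ip_norm : norm_from_inner ip.
Variables (M : H -> H) (t : R) (D : nat -> R).
Hypothesis symM : forall f g, ip (M f) g = ip f (M g).
Hypothesis linM : forall a f g, M (a *: f + g) = a *: M f + M g.
Hypothesis posM : forall f, 0 <= ip (M f) f.
Hypothesis traceM : forall n e, orthonormal_upto ip n e ->
  \sum_(i < n) ip (M (e i)) (e i) <= t.
Hypothesis D_eigen : eigenvalue_seq M D.
Implicit Types (f g h : H) (a : R).

Let D_dec i j : (i <= j)%N -> D j <= D i.
Proof. by case: D_eigen => + _ _; apply. Qed.

Lemma eigenvectors_orthogonal a b f g :
  M f = a *: f -> M g = b *: g -> a != b -> ip f g = 0.
Proof.
move=> Mf Mg ab; have := symM f g; rewrite Mf Mg ipZl ipZr => /eqP.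
by rewrite -subr_eq0 -mulrBl mulf_eq0 subr_eq0 (negbTE ab) => /eqP.
Qed.

Definition eigen_family n (e : nat -> H) :=
  orthonormal_upto ip n e /\ forall j, (j < n)%N -> M (e j) = D j *: e j.

Let multiples n l := [seq j <- iota 0 n | D j == l].

Let uniq_multiples n l : uniq (multiples n l).
Proof. by rewrite filter_uniq // iota_uniq. Qed.

Let mem_multiples n l j : (j \in multiples n l) = (D j == l) && (j < n)%N.
Proof. by rewrite mem_filter mem_iota. Qed.

(** The earlier indices with value D n, together with n itself, are among the p indices of that
    value, so fewer than p eigenvectors are taken and the p-dimensional eigenspace has room for
    another. Against other eigenvalues orthogonality is automatic. *)
Lemma eigen_family_exists n : (forall j, (j < n)%N -> 0 < D j) ->
  exists e, eigen_family n e.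
Proof.
elim: n => [_|n IHn D_gt0]; first by exists (fun=> 0).
have [j jn|e [eON eM]] := IHn; first exact/D_gt0/ltnW.
have Dn0 : 0 < D n by exact: D_gt0.
case: D_eigen => _ _ /(_ _ Dn0)[p Sp dimp].
pose js := multiples n (D n).
have js_p : (size js < p)%N.
  have un : uniq (n :: js) by rewrite /= uniq_multiples mem_multiples ltnn andbF.
  rewrite -card_le_II -(card_le_eql (card_uniq_seq un)) -(card_le_eqr Sp).
  apply: subset_card_le => j /=.
  by rewrite inE mem_multiples => /orP[/eqP->//|/andP[/eqP]].
have [f [fE f0 fe]] := has_dim_orthogonal_vector ip dimp (fun i => e (nth 0%N js i)) js_p.
pose h := `|f|^-1 *: f.
have Mh : M h = D n *: h by rewrite (op_scale linM) fE !scalerA mulrC.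
have he i : (i < n)%N -> ip h (e i) = 0.
  move=> in_; have [Di|Di] := eqVneq (D i) (D n); last first.
    by apply: eigenvectors_orthogonal Mh (eM _ in_) _; rewrite eq_sym.
  have ijs : i \in js by rewrite mem_multiples Di eqxx.
  by rewrite ipZl -(nth_index 0%N ijs) fe ?mulr0 // index_mem.
exists (fun i => if i == n then h else e i); split.
  exact: orthonormal_upto_rcons eON (normalize_unit ip_norm f0) he.
move=> j; rewrite ltnS leq_eqVlt; case: eqVneq => [->//|_ /=]; exact: eM.
Qed.

(** Otherwise the complement of the family contains an eigenvector for some l > D n. By monotonicity
    all p indices of value l lie below n, so the family already holds p orthonormal eigenvectors for
    l, and one more would exceed the dimension p of the eigenspace. *)
Lemma form_le_next n e f : eigen_family n e ->
  (forall i, (i < n)%N -> ip f (e i) = 0) -> ip (M f) f <= D n * ip f f.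
Proof.
move=> [eON eM] fe; rewrite leNgt; apply/negP => f_big.
pose V g := forall i, (i < n)%N -> ip g (e i) = 0.
have linV a g h : V g -> V h -> V (a *: g + h).
  by move=> Vg Vh i in_; rewrite ipDl ipZl Vg // Vh // mulr0 addr0.
have MV g : V g -> V (M g).
  by move=> Vg i in_; rewrite symM eM // ipZr Vg // mulr0.
have closedV (u : nat -> H) g : (forall k, V (u k)) -> u @ \oo --> g -> V g.
  move=> Vu ug i in_; have := cvg_ipl ip_norm (h := e i) ug.
  have -> : (fun k => ip (u k) (e i)) = fun=> 0 by apply/funext => k; exact: Vu.
  by move=> c0; apply: (cvg_unique _ c0 (cvg_cst _)); exact: Rhausdorff.
have Dn0 : 0 <= D n by case: D_eigen.
have [l [g [Dl Vg g0 Mg]]] :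
    exists l g, [/\ D n < l, V g, g != 0 & M g = l *: g].
  by apply: (top_eigenvector ip_norm symM linM posM traceM linV MV closedV Dn0); exists f.
case: D_eigen => _ _ /(_ _ (le_lt_trans Dn0 Dl))[p Sp dimp].
pose js := multiples n l.
have js_p : (p <= size js)%N.
  rewrite -card_le_II -(card_le_eqr (card_uniq_seq (uniq_multiples n l))).
  rewrite -(card_le_eql Sp); apply: subset_card_le => j /= Dj.
  rewrite mem_multiples Dj eqxx /= ltnNge; apply/negP => nj.
  by have := le_lt_trans (D_dec nj) Dl; rewrite Dj ltxx.
have nth_js i : (i < size js)%N -> nth 0%N js i \in js by exact: mem_nth.
have jsON : orthonormal_upto ip (size js) (fun i => e (nth 0%N js i)).
  move=> i j si sj; have := nth_js _ si; have := nth_js _ sj.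
  rewrite !mem_multiples => /andP[_ jn] /andP[_ in_].
  by rewrite eON // nth_uniq // uniq_multiples.
have hjs i : (i < size js)%N -> ip (`|g|^-1 *: g) (e (nth 0%N js i)) = 0.
  move=> /nth_js; rewrite mem_multiples => /andP[_ in_].
  by rewrite ipZl Vg // mulr0.
suff : (size js < p)%N by rewrite ltnNge js_p.
apply: (orthonormal_le_dim dimp
  (orthonormal_upto_rcons jsON (normalize_unit ip_norm g0) hjs)) => i.
rewrite ltnS leq_eqVlt; case: eqVneq => [_ _|_ /= /nth_js].
  by rewrite /= (op_scale linM) Mg !scalerA mulrC.
by rewrite mem_multiples => /andP[/eqP Dj jn] /=; rewrite eM // Dj.
Qed.

(** More than t / eta orthonormal eigenvectors with eigenvalues above [eta] would violate the trace
    bound. Taking the least admissible n makes all eigenvalues before it positive, as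
    [eigen_family_exists] demands. *)
Lemma eigenvalue_cutoff r (eta : R) : 0 < eta -> (0 < r)%N -> 0 < D r.-1 ->
  exists n, [/\ (r <= n)%N, forall j, (j < n)%N -> 0 < D j & D n <= eta].
Proof.
move=> eta0 r0 Dr0.
have exn : exists n, (r <= n)%N && (D n <= eta).
  apply: contrapT => no_n.
  have D_big j : eta < D j.
    rewrite ltNge; apply/negP => Dj; apply: no_n; exists (maxn r j).
    by rewrite leq_maxl /=; apply: le_trans Dj; apply: D_dec; exact: leq_maxr.
  pose n := (Num.truncn (t / eta)).+1.
  have [e [eON eM]] : exists e, eigen_family n e.
    by apply: eigen_family_exists => j _; exact: lt_trans (D_big j).
  have := traceM eON; rewrite leNgt => /negP; apply.
  have : t < n%:R * eta.
    by rewrite -ltr_pdivrMr //; exact: truncnS_gt.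
  move/lt_le_trans; apply; rewrite mulr_natl -[n in _ *+ n]card_ord -sumr_const.
  apply: ler_sum => i _; rewrite eM // ipZl eON // eqxx mulr1; exact/ltW.
have [n /andP[rn Dn] n_min] := ex_minnP exn.
exists n; split=> // j jn; have [jr|rj] := ltnP j r.
  by apply: lt_le_trans Dr0 _; apply: D_dec; rewrite -ltnS prednK.
rewrite (lt_trans eta0) // ltNge; apply/negP => Dj.
by have := n_min j; rewrite rj Dj => /(_ isT); rewrite leqNgt jn.
Qed.

Lemma spectral_cutoff r (eta : R) : 0 < eta -> (0 < r)%N -> 0 < D r.-1 ->
  exists n e, [/\ (r <= n)%N, eigen_family n e &
    forall f, ip (M f) f <= \sum_(j < n) D j * ip f (e j) ^+ 2 + eta * ip f f].
Proof.
move=> eta0 r0 Dr0; have [n [rn Dn0 Dn]] := eigenvalue_cutoff eta0 r0 Dr0.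
have [e eE] := eigen_family_exists Dn0; have [eON eM] := eE.
exists n, e; split=> // f; pose g := f - \sum_(j < n) ip f (e j) *: e j.
have Mfe (j : 'I_n) : ip (M f) (e j) = D j * ip f (e j).
  by rewrite symM eM // ipZr.
(* [M] preserves each line spanned by an [e j], hence commutes with removing their span: the
   residual of [M f] is [M g]. *)
have MgE : M f - \sum_(j < n) ip (M f) (e j) *: e j = M g.
  have M0 : M 0 = 0 by have := op_scale linM 0 0; rewrite !scale0r.
  have MD x y : M (x + y) = M x + M y by rewrite -[x in LHS]scale1r linM scale1r.
  rewrite /g MD; congr (_ + _); rewrite -[in RHS]scaleN1r (op_scale linM) scaleN1r.
  congr (- _); rewrite (big_morph _ MD M0); apply: eq_bigr => j _.
  by rewrite (op_scale linM) Mfe eM // scalerA mulrC.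
rewrite (bessel_residual (M f) f eON) MgE -/g; apply: lerD.
  by apply: ler_sum => j _; rewrite Mfe -mulrA -expr2.
have gg : ip g g <= ip f f.
  rewrite [leRHS](bessel_residual f f eON) lerDr sumr_ge0 // => j _.
  by rewrite -expr2 sqr_ge0.
apply: le_trans (form_le_next eE _) _.
  by move=> i in_; exact: residual_orthogonal.
by apply: ler_pM => //; [case: D_eigen|exact: ip_ge0].
Qed.

End Eigenbasis.

(** * Integrals of V-statistics *)

Section Integrals.
Context d (T : measurableType d) (R : realType) (mu : {measure set T -> \bar R}).
Hypothesis mu_fin : (mu setT < +oo)%E.

Lemma bounded_integrable (f : T -> R) (B : R) : measurable_fun setT f ->
  (forall w, `|f w| <= B) -> mu.-integrable setT (EFin \o f).
Proof.
move=> mf fB; apply: measurable_bounded_integrable => //.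
exists B; split; first exact: num_real.
by move=> C BC w _; exact: le_trans (fB w) (ltW BC).
Qed.
End Integrals.

Section Probability.
Context d (T : measurableType d) (R : realType) (P : probability T R).
Local Open Scope ereal_scope.

Lemma probability_bounded_integrable (f : T -> R) (B : R) : measurable_fun setT f ->
  (forall w, `|f w| <= B)%R -> P.-integrable setT (EFin \o f).
Proof.
move=> mf; apply: bounded_integrable mf.
exact: (le_lt_trans (probability_le1 P measurableT) (ltry 1)).
Qed.

Lemma probability_integral_le (f : T -> R) (c : R) :
  P.-integrable setT (EFin \o f) -> (forall w, f w <= c)%R ->
  \int[P]_w (f w)%:E <= c%:E.
Proof.
move=> intf fc; have -> : c%:E = \int[P]_w c%:E.
  rewrite [RHS](integral_cst P measurableT c%:E) -[LHS]mule1; congr (_ * _).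
  exact/esym/probability_setT.
have intc : P.-integrable setT (EFin \o (fun=> c)).
  exact: probability_bounded_integrable (measurable_cst c) (fun=> lexx `|c|%R).
by apply: le_integral => // w _; rewrite lee_fin.
Qed.

Lemma markov_integral (f : T -> R) (c b : R) : measurable_fun setT f ->
  (forall w, 0 <= f w)%R -> (0 < c)%R -> \int[P]_w (f w)%:E <= b%:E ->
  P [set w | (c <= f w)%R] <= (b / c)%:E.
Proof.
move=> mf f0 c0 fb.
have /measurable_EFinP mE := mf.
have := @le_integral_comp_abse _ _ _ P setT measurableT (EFin \o f) c id
  (@measurable_id _ _ setT) (fun r r0 => r0) (fun x y _ _ xy => xy)
  mE c0.
rewrite setTI; under eq_integral do rewrite /= ger0_norm ?f0 //.
have -> : [set x | c%:E <= `|(EFin \o f) x|] = [set w | (c <= f w)%R].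
  by apply/seteqP; split=> w /=; rewrite ger0_norm ?f0 // lee_fin.
move=> /le_trans/(_ fb).
by rewrite EFinM muleC lee_pdivlMr.
Qed.
End Probability.

Lemma product_bounded_integrable d (X : measurableType d) (R : realType)
    (rho : probability X R) (g : X * X -> R) (B : R) : measurable_fun setT g ->
  (forall z, `|g z| <= B) -> (rho \x rho)%E.-integrable setT (EFin \o g).
Proof.
move=> mg gB; suff fin : ((rho \x rho)%E setT < +oo)%E.
  exact: (bounded_integrable fin mg gB).
rewrite -setXTT product_measure1E //; apply: lte_mul_pinfty => //.
  exact: fin_num_measure.
exact: le_lt_trans (probability_le1 rho measurableT) (ltry 1).
Qed.

Section Sample.
Context d d' (T : measurableType d) (X : measurableType d') (R : realType).
Variables (P : probability T R) (rho : probability X R) (N : nat).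
Variable x : 'I_N -> {RV P >-> X}.
Hypothesis x_iid : iid_sample rho x.
Local Open Scope ereal_scope.

Section Pair.
Variables i l : 'I_N.

Lemma measurable_pair : measurable_fun setT (fun w => (x i w, x l w)).
Proof. by apply: measurable_fun_pair; exact: measurable_funPT. Qed.

Let pair_mixin := isMeasurableFun.Build _ _ _ _ _ measurable_pair.
Let pair : {mfun T >-> (X * X)%type} := MeasurableFun.Pack (MeasurableFun.Class pair_mixin).

Lemma pair_distribution (A : set (X * X)%type) : i != l -> measurable A ->
  (rho \x rho) A = distribution P pair A.
Proof.
move=> il; apply: product_measure_unique => B C mB mC.
have [law indep] := x_iid.
(* Independence for the pair {i, l}: every index other than [i] is given the event [C], of which
   only the one at [l] is read. *)
have := indep (i |: [set l])%SET (fun k => if k == i then B else C) _.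
rewrite big_setU1 ?inE //= big_set1 eqxx eq_sym (negbTE il) => /(_ _)/esym.
rewrite -(law i B mB) -(law l C mC) => -> => [|k]; last by case: ifP.
congr (P _); apply/seteqP; split=> w /= => [[Bw Cw] k|h].
  rewrite !inE => /orP[/eqP->|/eqP->]; first by rewrite eqxx.
  by rewrite eq_sym (negbTE il).
split; first by have := h i; rewrite !inE !eqxx /=; apply.
by have := h l; rewrite !inE eqxx orbT eq_sym (negbTE il); apply.
Qed.

Lemma integral_pair (g : (X * X)%type -> R) (B : R) : i != l -> measurable_fun setT g ->
  (forall z, `|g z| <= B)%R ->
  \int[P]_w (g (x i w, x l w))%:E = \int[rho]_u fubini_F rho (EFin \o g) u.
Proof.
move=> il mg gB.
have /measurable_EFinP mE := mg.
rewrite (integral12_prod_meas1 (f := EFin \o g)); last first.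
  exact (product_bounded_integrable rho mg gB).
rewrite (eq_measure_integral (distribution P pair)); last first.
  by move=> A mA _; exact: pair_distribution.
rewrite integral_distribution //.
apply: (@probability_bounded_integrable _ _ _ P (g \o pair) B) => [|w].
  by apply: measurableT_comp => //; exact: measurable_pair.
exact: gB.
Qed.

End Pair.

(* The mean of a V-statistic: the off-diagonal pairs have law [rho \x rho]. *)
Lemma vstat_tail (g : (X * X)%type -> R) (B eta tau : R) : measurable_fun setT g ->
  (forall z, `|g z| <= B)%R -> (0 <= eta)%R -> (0 < tau)%R -> (0 < N)%N ->
  (forall u, \int[rho]_v (g (u, v))%:E <= eta%:E) ->
  (forall w, 0 <= \sum_(i < N) \sum_(l < N) g (x i w, x l w))%R ->
  P [set w | (tau * N%:R ^+ 2 <= \sum_(i < N) \sum_(l < N) g (x i w, x l w))%R]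
    <= ((eta + B / N%:R) / tau)%:E.
Proof.
move=> mg gB eta0 tau0 N0 g_eta g_ge0.
have mgx i l : measurable_fun setT (fun w => g (x i w, x l w)).
  by apply: measurableT_comp mg _; exact: measurable_pair.
have intgx i l : P.-integrable setT (EFin \o (fun w => g (x i w, x l w))).
  by apply: probability_bounded_integrable (mgx i l) _ => w; exact: gB.
(* A diagonal pair does not have the product law and gets the crude bound [B]; there are N of these
   among N^2 pairs, whence the term B / N. *)
have le_pair i l : \int[P]_w (g (x i w, x l w))%:E <= (eta + B * (i == l)%:R)%:E.
  have [->|il] := eqVneq i l.
    apply: probability_integral_le => // w; rewrite mulr1.
    by apply: le_trans (ler_norm _) _; rewrite (le_trans (gB _)) // lerDr.
  rewrite mulr0 addr0 (integral_pair il mg gB).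
  have -> : eta%:E = \int[rho]_u eta%:E.
    rewrite [RHS](integral_cst rho measurableT eta%:E) -[LHS]mule1.
    by congr (_ * _); exact/esym/probability_setT.
  have prod_int := product_bounded_integrable rho mg gB.
  apply: le_integral => //.
  - exact: integrable_fubini_F prod_int.
  - exact: probability_bounded_integrable (measurable_cst eta) (fun=> lexx `|eta|%R).
  - by move=> u _; exact: g_eta.
pose S w := (\sum_(p : 'I_N * 'I_N) g (x p.1 w, x p.2 w))%R.
have SE w : (\sum_(i < N) \sum_(l < N) g (x i w, x l w))%R = S w.
  by rewrite pair_bigA.
have mS : measurable_fun setT S by apply: measurable_sum => p; exact: mgx.
have S_le : \int[P]_w (S w)%:E <= (N%:R ^+ 2 * eta + N%:R * B)%:E.
  have -> : \int[P]_w (S w)%:E =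
      \sum_(p : 'I_N * 'I_N) \int[P]_w (g (x p.1 w, x p.2 w))%:E.
    under eq_integral do rewrite /S -sumEFin.
    exact: (integral_sum measurableT (fun p => intgx p.1 p.2)).
  have sum_le : \sum_(p : 'I_N * 'I_N) \int[P]_w (g (x p.1 w, x p.2 w))%:E <=
      \sum_(p : 'I_N * 'I_N) (eta + B * (p.1 == p.2)%:R)%:E.
    by apply: lee_sum => p _; exact: le_pair.
  apply: le_trans sum_le _; rewrite sumEFin lee_fin big_split /= sumr_const card_prod card_ord.
  rewrite -(pair_bigA _ (fun i l => B * (i == l)%:R))%R /=.
  rewrite (eq_bigr (fun=> B)) => [|i _]; last first.
    rewrite (bigD1 i) //= eqxx mulr1 big1 ?addr0 // => l li.
    by rewrite eq_sym (negbTE li) mulr0.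
  rewrite sumr_const card_ord -[(eta *+ _)%R]mulr_natl -[(B *+ _)%R]mulr_natl.
  by rewrite natrM -expr2.
under eq_set do rewrite SE.
apply: le_trans (markov_integral mS _ _ S_le) _.
- by move=> w; rewrite -SE.
- by rewrite mulr_gt0 // exprn_gt0 // ltr0n.
rewrite lee_fin le_eqVlt; apply/orP; left; apply/eqP.
by field; rewrite ?pnatr_eq0 -?lt0n ?N0 ?gt_eqF.
Qed.

End Sample.

(** * Eigenvalues of Gram matrices *)

Lemma sqr_sum_le (R : realFieldType) n (c : 'I_n -> R) :
  (\sum_i c i) ^+ 2 <= n%:R * \sum_i c i ^+ 2.
Proof.
have amgm : (\sum_i c i) ^+ 2 <= \sum_i \sum_j (c i ^+ 2 / 2 + c j ^+ 2 / 2).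
  rewrite expr2 mulr_suml; apply: ler_sum => i _; rewrite mulr_sumr.
  by apply: ler_sum => j _; have := sqr_ge0 (c i - c j); rewrite sqrrB; lra.
apply: le_trans amgm _; under eq_bigr do rewrite big_split sumr_const card_ord /=.
rewrite big_split sumr_const card_ord sumrMnl -!mulr_suml /= -[_ *+ n]mulr_natl; lra.
Qed.

Section GramEigenvalues.
Variables (R : realType) (H : completeNormedModType R) (ip : {dot H for idfun}).
Variables (N : nat) (y : 'I_N -> H) (s : seq R).
Hypothesis N_gt0 : (0 < N)%N.
Let A : 'M[R]_N := N%:R^-1 *: \matrix_(i, j) ip (y i) (y j).
Hypothesis s_eigen : matrix_eigenvalues A s.

Let symA : A^T = A.
Proof. by apply/matrixP => i j; rewrite !mxE ipC. Qed.

Let charA : char_poly A = \prod_(a <- s) ('X - a%:P).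
Proof. by case: s_eigen. Qed.

Let Ngt0 : 0 < N%:R :> R. Proof. by rewrite ltr0n. Qed.

Lemma gram_form (u : 'rV[R]_N) : (u *m A *m u^T) 0 0 =
  N%:R^-1 * ip (\sum_i u 0 i *: y i) (\sum_i u 0 i *: y i).
Proof.
rewrite mxE ip_sumr mulr_sumr; apply: eq_bigr => j _.
rewrite !mxE ipZr ip_suml mulr_suml !mulr_sumr; apply: eq_bigr => i _.
by rewrite !mxE ipZl; ring.
Qed.

Lemma gram_eigenvalues_ge0 i : 0 <= s`_i.
Proof.
apply: (eigenvalues_ge0 symA charA) => u; rewrite gram_form.
by rewrite mulr_ge0 ?ip_ge0 // invr_ge0 ltW.
Qed.

Variables (n : nat) (e : nat -> H) (D : nat -> R) (tau : R).
Hypothesis eON : orthonormal_upto ip n e.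
Hypothesis D_dec : nonincreasing_seq D.
Hypothesis D_ge0 : forall j, 0 <= D j.
Hypothesis tau_ge0 : 0 <= tau.
Let W (j l : nat) := N%:R^-1 * \sum_i ip (y i) (e j) * ip (y i) (e l).
Hypothesis W_near : forall j l, (j < n)%N -> (l < n)%N ->
  `|W j l - D j * (j == l)%:R| <= tau.

(** An entrywise error [tau] costs at most (sum |c_j|)^2 tau <= n tau sum c_j^2. *)
Lemma compressed_form_ge k (c : 'I_k.+1 -> R) : (k < n)%N ->
  (D k - n%:R * tau) * \sum_(j < k.+1) c j ^+ 2 <=
    \sum_(j < k.+1) \sum_(l < k.+1) c j * c l * W j l.
Proof.
move=> kn.
have jn (j : 'I_k.+1) : (j < n)%N by exact: leq_ltn_trans (leq_ord j) kn.
have main : \sum_(j < k.+1) \sum_(l < k.+1)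
      (c j * c l * (D j * (j == l)%:R) - `|c j| * `|c l| * tau) <=
    \sum_(j < k.+1) \sum_(l < k.+1) c j * c l * W j l.
  apply: ler_sum => j _; apply: ler_sum => l _.
  have : `|c j * c l * (W j l - D j * (j == l)%:R)| <= `|c j| * `|c l| * tau.
    by rewrite !normrM ler_wpM2l ?mulr_ge0 //; exact: W_near.
  by rewrite ler_norml => /andP[+ _]; lra.
apply: le_trans main.
have -> : \sum_(j < k.+1) \sum_(l < k.+1)
      (c j * c l * (D j * (j == l)%:R) - `|c j| * `|c l| * tau) =
    \sum_(j < k.+1) D j * c j ^+ 2 - (\sum_(j < k.+1) `|c j|) ^+ 2 * tau.
  under eq_bigr do rewrite sumrB.
  rewrite sumrB; congr (_ - _).
    apply: eq_bigr => j _; rewrite (bigD1 j) //= eqxx mulr1 big1 ?addr0.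
      by rewrite expr2 mulrC.
    by move=> l /negbTE lj; rewrite eq_sym lj !mulr0.
  rewrite expr2 mulr_suml mulr_suml; apply: eq_bigr => j _.
  by rewrite mulr_sumr mulr_suml.
have sq_le : (\sum_(j < k.+1) `|c j|) ^+ 2 * tau <= n%:R * tau * \sum_(j < k.+1) c j ^+ 2.
  suff h : (\sum_(j < k.+1) `|c j|) ^+ 2 <= n%:R * \sum_(j < k.+1) c j ^+ 2.
    by have := ler_wpM2r tau_ge0 h; lra.
  apply: le_trans (sqr_sum_le _) _.
  under eq_bigr do rewrite real_normK ?num_real //.
  by rewrite ler_wpM2r ?ler_nat // sumr_ge0 // => j _; exact: sqr_ge0.
have D_le : D k * \sum_(j < k.+1) c j ^+ 2 <= \sum_(j < k.+1) D j * c j ^+ 2.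
  rewrite mulr_sumr; apply: ler_sum => j _; rewrite ler_wpM2r ?sqr_ge0 //.
  exact/D_dec/leq_ord.
lra.
Qed.

(** Take f in the span of e_0, ..., e_k, u_i = <y_i, f> and v = sum u_i y_i. Then <v, f> = |u|^2 >=
    N b |f|^2, and Cauchy-Schwarz for v and f turns this into the Rayleigh bound |v|^2 / N >= b
    |u|^2. *)
Lemma gram_eigenvalue_ge k : (k < n)%N -> (n <= N)%N -> D k - n%:R * tau <= s`_k.
Proof.
move=> kn nN; have [b0|b0] := leP (D k - n%:R * tau) 0.
  exact: le_trans b0 (gram_eigenvalues_ge0 _).
set b := D k - n%:R * tau in b0 *.
pose U : 'M[R]_(k.+1, N) := \matrix_(j, i) ip (y i) (e j).
apply: (eigenvalue_lower_bound symA charA (U := U)).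
- by case: s_eigen.
- exact: leq_trans kn nN.
move=> c c0; pose f := \sum_(j < k.+1) c 0 j *: e j; pose u := c *m U.
have uE i : u 0 i = ip (y i) f.
  by rewrite mxE ip_sumr; apply: eq_bigr => j _; rewrite mxE ipZr.
have ff : ip f f = \sum_j c 0 j ^+ 2.
  rewrite {2}/f ip_sumr; apply: eq_bigr => j _; rewrite ipZr expr2; congr (_ * _).
  have kON : orthonormal_upto ip k.+1 e.
    by move=> i l ik lk; apply: eON; [exact: leq_trans ik kn|exact: leq_trans lk kn].
  pose z i := if insub i is Some i' then c 0 (i' : 'I_k.+1) else 0.
  have zE (i : 'I_k.+1) : z i = c 0 i by rewrite /z valK.
  have := orthonormal_upto_sum z kON (ltn_ord j); rewrite zE => <-.
  by congr (ip _ _); apply: eq_bigr => i _; rewrite zE.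
have ff0 : 0 < ip f f.
  have [i ci] : exists i, c 0 i != 0.
    apply: contrapT => /forallNP ci; case/eqP: c0; apply/rowP => i; rewrite mxE.
    by apply/eqP; apply: contrapT; move/negP/(ci i).
  rewrite ff (bigD1 i) //= ltr_pwDl ?exprn_even_gt0 // sumr_ge0 // => j _.
  exact: sqr_ge0.
have uu : (u *m u^T) 0 0 = N%:R * \sum_(j < k.+1) \sum_(l < k.+1) c 0 j * c 0 l * W j l.
  rewrite mx11_row_sum.
  have -> : \sum_i u 0 i * u 0 i =
      \sum_i \sum_(j < k.+1) \sum_(l < k.+1) c 0 j * c 0 l * (ip (y i) (e j) * ip (y i) (e l)).
    apply: eq_bigr => i _; rewrite uE ip_sumr mulr_suml; apply: eq_bigr => j _.
    rewrite mulr_sumr; apply: eq_bigr => l _; rewrite !ipZr; ring.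
  rewrite exchange_big mulr_sumr; apply: eq_bigr => j _.
  rewrite exchange_big mulr_sumr; apply: eq_bigr => l _.
  by rewrite -mulr_sumr /W; field; rewrite gt_eqF.
have uu_ge : N%:R * b * ip f f <= (u *m u^T) 0 0.
  rewrite uu -mulrA ler_pM2l // ff; exact: compressed_form_ge.
have uu0 : 0 < (u *m u^T) 0 0.
  by apply: lt_le_trans uu_ge; rewrite !mulr_gt0.
split; first by rewrite -row_sqnorm_eq0 -/u gt_eqF.
rewrite -/u gram_form; set v := \sum_i u 0 i *: y i.
have vf : ip v f = (u *m u^T) 0 0.
  by rewrite mx11_row_sum ip_suml; apply: eq_bigr => i _; rewrite ipZl uE.
have := cauchy_schwarz ip v f; rewrite vf expr2 => cs.
rewrite -(ler_pM2r ff0) -(ler_pM2l Ngt0).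
have -> : N%:R * (N%:R^-1 * ip v v * ip f f) = ip v v * ip f f.
  by field; rewrite gt_eqF.
apply: le_trans cs; apply: le_trans (ler_wpM2r (ltW uu0) uu_ge).
by rewrite le_eqVlt; apply/orP; left; apply/eqP; ring.
Qed.

Variables (B taup : R).
Hypothesis tau_le1 : tau <= 1.
Hypothesis D_le : forall j, D j <= B.
Hypothesis residual_le : \sum_i \sum_l
  (ip (y i) (y l) ^+ 2 - (\sum_(j < n) ip (y i) (e j) * ip (y l) (e j)) ^+ 2)
    <= taup * N%:R ^+ 2.

(** With a the matrix of coefficients <y_i, e_j>, this is the equality of Frobenius norms |a a^T| =
    |a^T a|, where a^T a = N W. *)
Lemma sum_sqr_compression :
  \sum_i \sum_l (\sum_(j < n) ip (y i) (e j) * ip (y l) (e j)) ^+ 2 =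
  N%:R ^+ 2 * \sum_(j < n) \sum_(l < n) W j l ^+ 2.
Proof.
pose a i j := ip (y i) (e j).
have -> : \sum_i \sum_l (\sum_(j < n) ip (y i) (e j) * ip (y l) (e j)) ^+ 2 =
    \sum_i \sum_l \sum_(j < n) \sum_(k < n) (a i j * a i k) * (a l j * a l k).
  apply: eq_bigr => i _; apply: eq_bigr => l _; rewrite expr2 mulr_suml.
  apply: eq_bigr => j _; rewrite mulr_sumr; apply: eq_bigr => k _.
  by rewrite /a; ring.
under eq_bigr do rewrite exchange_big /=.
rewrite exchange_big mulr_sumr; apply: eq_bigr => j _ /=.
under eq_bigr do rewrite exchange_big /=.
rewrite exchange_big mulr_sumr; apply: eq_bigr => k _ /=.
under eq_bigr do rewrite -mulr_sumr.
rewrite -mulr_suml -expr2 /W exprMn mulrA exprVn mulfV ?mul1r //.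
by rewrite expf_neq0 // gt_eqF.
Qed.

(** The squares of all eigenvalues total at most sum D_j^2 plus errors, and every other leading
    s_j^2 is nearly D_j^2 or more; subtracting those isolates s_k^2. *)
Lemma gram_eigenvalue_sqr_le k : (k < n)%N -> (n <= N)%N ->
  s`_k ^+ 2 <= D k ^+ 2 + taup + n%:R ^+ 2 * (4 * B + 1) * tau.
Proof.
move=> kn nN.
have B0 : 0 <= B by exact: le_trans (D_ge0 0) (D_le 0).
have total : \sum_(i < N) s`_i ^+ 2 <=
    taup + \sum_(j < n) \sum_(l < n) W j l ^+ 2.
  rewrite (sum_sqr_eigenvalues symA charA).
  have -> : \sum_(i < N) \sum_(j < N) A i j ^+ 2 =
      (N%:R ^+ 2)^-1 * \sum_i \sum_l ip (y i) (y l) ^+ 2.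
    rewrite mulr_sumr; apply: eq_bigr => i _.
    rewrite mulr_sumr; apply: eq_bigr => l _.
    by rewrite !mxE exprMn exprVn.
  rewrite mulrC ler_pdivrMr ?exprn_gt0 //.
  rewrite mulrDl [X in _ + X]mulrC -sum_sqr_compression -lerBlDr.
  apply: le_trans residual_le; rewrite -sumrB.
  by under [leRHS]eq_bigr do rewrite sumrB.
have W_le : \sum_(j < n) \sum_(l < n) W j l ^+ 2 <=
    \sum_(j < n) D j ^+ 2 + n%:R ^+ 2 * ((2 * B + 1) * tau).
  have -> : \sum_(j < n) D j ^+ 2 + n%:R ^+ 2 * ((2 * B + 1) * tau) =
      \sum_(j < n) \sum_(l < n) ((D j * (j == l)%:R) ^+ 2 + (2 * B + 1) * tau).
    under [RHS]eq_bigr do rewrite big_split sumr_const card_ord /=.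
    rewrite big_split sumr_const card_ord /=; congr (_ + _).
      apply: eq_bigr => j _; rewrite (bigD1 j) //= eqxx mulr1 big1 ?addr0 //.
      by move=> l /negbTE lj; rewrite eq_sym lj mulr0 expr0n.
    by rewrite -mulrnA -[RHS]mulr_natl natrM expr2.
  apply: ler_sum => j _; apply: ler_sum => l _.
  have := W_near (ltn_ord j) (ltn_ord l).
  have -> : ((j : nat) == l) = (j == l) by [].
  set p := D j * _; set q := W j l.
  have p0 : 0 <= p by rewrite mulr_ge0.
  have pB : p <= B.
    by rewrite /p; case: (j == l); rewrite ?mulr1 // mulr0.
  rewrite ler_norml => /andP[h1 h2].
  (* From |q - p| <= tau <= 1 and 0 <= p <= B follows q^2 <= p^2 + (2B + 1) tau; these nonnegative
     products certify it. *)
  have : 0 <= (q - p + tau) * (tau - (q - p)) by rewrite mulr_ge0; lra.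
  have : 0 <= (B - p) * tau by rewrite mulr_ge0 // subr_ge0.
  have : 0 <= p * (tau - (q - p)) by rewrite mulr_ge0 //; lra.
  have : 0 <= tau * (1 - tau) by rewrite mulr_ge0 // subr_ge0.
  nra.
have s_low (j : 'I_n) : D j ^+ 2 - 2 * n%:R * B * tau <= s`_j ^+ 2.
  have sj := gram_eigenvalue_ge (ltn_ord j) nN.
  have s0 := gram_eigenvalues_ge0 j.
  have nt0 : 0 <= n%:R * tau by rewrite mulr_ge0.
  have DB : D j * (n%:R * tau) <= B * (n%:R * tau) by rewrite ler_wpM2r.
  have [b0|b0] := leP (D j - n%:R * tau) 0.
    have : D j * (D j - n%:R * tau) <= 0 by rewrite mulr_ge0_le0.
    have := sqr_ge0 s`_j.
    have : 0 <= B * (n%:R * tau) by rewrite mulr_ge0.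
    nra.
  have : (D j - n%:R * tau) ^+ 2 <= s`_j ^+ 2.
    by rewrite ler_pXn2r // nnegrE ltW.
  nra.
have split_N : \sum_(j < n) s`_j ^+ 2 <= \sum_(i < N) s`_i ^+ 2.
  rewrite -!(big_mkord xpredT (fun i => s`_i ^+ 2)) (big_cat_nat (leq0n n) nN) //= lerDl.
  by apply: sumr_ge0 => i _; exact: sqr_ge0.
rewrite (bigD1 (Ordinal kn)) //= in split_N.
have rest : \sum_(j < n | j != Ordinal kn) (D j ^+ 2 - 2 * n%:R * B * tau) <=
    \sum_(j < n | j != Ordinal kn) s`_j ^+ 2 by apply: ler_sum.
have cnt : \sum_(j < n | j != Ordinal kn) (2 * n%:R * B * tau) <=
    n%:R * (2 * n%:R * B * tau).
  rewrite sumr_const -[leLHS]mulr_natl ler_wpM2r ?mulr_ge0 // ler_nat.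
  by apply: leq_trans (max_card _) _; rewrite card_ord.
rewrite sumrB in rest.
have D_split : \sum_(j < n) D j ^+ 2 =
    D k ^+ 2 + \sum_(j < n | j != Ordinal kn) D j ^+ 2.
  by rewrite (bigD1 (Ordinal kn)).
(* The losses in the lower bounds and the entry errors of W add up to the stated constant. *)
have : n%:R * (2 * n%:R * B * tau) + n%:R ^+ 2 * ((2 * B + 1) * tau) =
    n%:R ^+ 2 * (4 * B + 1) * tau by ring.
lra.
Qed.

Lemma gram_eigenvalue_near k (delta : R) : (k < n)%N -> (n <= N)%N ->
  0 <= delta -> n%:R * tau <= delta ->
  taup + n%:R ^+ 2 * (4 * B + 1) * tau <= delta ^+ 2 -> `|s`_k - D k| <= delta.
Proof.
move=> kn nN d0 lo hi.
have := gram_eigenvalue_ge kn nN; have up := gram_eigenvalue_sqr_le kn nN.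
have : s`_k <= D k + delta.
  rewrite -(ler_pXn2r (ltn0Sn 1)) ?nnegrE ?addr_ge0 ?gram_eigenvalues_ge0 //.
  have : 0 <= D k * delta by rewrite mulr_ge0.
  rewrite sqrrD; lra.
rewrite ler_norml; lra.
Qed.

End GramEigenvalues.

(* Writing [<y_i, y_l> = p_il + q_il] with [q] the Gram matrix of the residuals,
   both [sum p q] and [sum q^2] are nonnegative. *)
Lemma gram_residual_ge0 (R : realType) (H : completeNormedModType R)
    (ip : {dot H for idfun}) N (y : 'I_N -> H) n e : orthonormal_upto ip n e ->
  0 <= \sum_i \sum_l (ip (y i) (y l) ^+ 2 -
    (\sum_(j < n) ip (y i) (e j) * ip (y l) (e j)) ^+ 2).
Proof.
move=> eON; pose z i := y i - \sum_(j < n) ip (y i) (e j) *: e j.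
have -> : \sum_i \sum_l (ip (y i) (y l) ^+ 2 -
      (\sum_(j < n) ip (y i) (e j) * ip (y l) (e j)) ^+ 2) =
    \sum_i \sum_l ip (z i) (z l) ^+ 2 +
      2 * \sum_(j < n) ip (\sum_i ip (y i) (e j) *: z i) (\sum_i ip (y i) (e j) *: z i).
  have -> : \sum_(j < n) ip (\sum_i ip (y i) (e j) *: z i) (\sum_i ip (y i) (e j) *: z i)
      = \sum_i \sum_l (\sum_(j < n) ip (y i) (e j) * ip (y l) (e j)) * ip (z i) (z l).
    under eq_bigr do rewrite ip_suml.
    rewrite exchange_big; apply: eq_bigr => i _ /=.
    under eq_bigr do rewrite ip_sumr.
    rewrite exchange_big; apply: eq_bigr => l _ /=.
    by rewrite mulr_suml; apply: eq_bigr => j _; rewrite ipZl ipZr mulrA.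
  rewrite mulr_sumr -big_split; apply: eq_bigr => i _ /=.
  rewrite mulr_sumr -big_split; apply: eq_bigr => l _ /=.
  by rewrite (bessel_residual (y i) (y l) eON) -/(z i) -/(z l); ring.
rewrite addr_ge0 ?mulr_ge0 ?sumr_ge0 // => [i _|j _]; last exact: ip_ge0.
by apply: sumr_ge0 => l _; exact: sqr_ge0.
Qed.

(** * The covariance operator *)

Section HasMean.
Context d (X : measurableType d) (R : realType) (rho : probability X R).
Implicit Types f g : X -> R.

(** Integrability and value are bundled so that the mean of a compound expression can be assembled
    term by term. *)
Definition has_mean f (a : R) := rho.-integrable setT (EFin \o f) /\
  (\int[rho]_x (f x)%:E = a%:E)%E.

Lemma has_mean_cst a : has_mean (fun=> a) a.
Proof.
split; first exact: probability_bounded_integrable (measurable_cst a) (fun=> lexx `|a|).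
rewrite [LHS](integral_cst rho measurableT a%:E) -[RHS]mule1.
by congr (_ * _)%E; exact: probability_setT.
Qed.

Lemma has_meanD f g a b : has_mean f a -> has_mean g b ->
  has_mean (fun x => f x + g x) (a + b).
Proof.
move=> [fi fa] [gi gb]; split.
  by have := integrableD measurableT fi gi; congr (rho.-integrable setT _).
under eq_integral do rewrite EFinD.
by rewrite (integralD measurableT fi gi) EFinD fa gb.
Qed.

Lemma has_meanZ f a c : has_mean f a -> has_mean (fun x => c * f x) (c * a).
Proof.
move=> [fi fa]; split.
  by have := integrableZl measurableT c fi; congr (rho.-integrable setT _).
under eq_integral do rewrite EFinM.
by rewrite (integralZl measurableT fi) fa EFinM.
Qed.

Lemma has_mean_sum (I : finType) (f : I -> X -> R) (a : I -> R) :
  (forall i, has_mean (f i) (a i)) ->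
  has_mean (fun x => \sum_i f i x) (\sum_i a i).
Proof.
move=> fa; elim: (index_enum I) => [|i r IHr].
  under [fun x => _]eq_fun do rewrite big_nil.
  by rewrite big_nil; exact: has_mean_cst.
under [fun x => _]eq_fun do rewrite big_cons.
by rewrite big_cons; exact: has_meanD.
Qed.

Lemma has_mean_le f a c : has_mean f a -> (forall x, f x <= c) -> a <= c.
Proof.
by move=> [fi fa] fc; rewrite -lee_fin -fa; exact: probability_integral_le.
Qed.

End HasMean.

Section Covariance.
Context d (X : measurableType d) (R : realType).
Variables (K : X -> X -> R) (kappa : R).
Variables (H : completeNormedModType R) (ip : {dot H for idfun}).
Hypothesis ip_norm : norm_from_inner ip.
Variables (rho : probability X R) (phi : X -> H) (m : H) (M : H -> H).
Hypothesis K_meas : measurable_fun setT (fun z : X * X => K z.1 z.2).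
Hypothesis K_bounded : forall x, K x x <= kappa ^+ 2.
Hypothesis phi_feature : feature_map ip K phi.
Hypothesis m_mean : is_expectation ip rho phi m.
Hypothesis M_cov : is_covariance ip rho phi m M.

Definition centered (x : X) : H := phi x - m.

(** The triangle inequality for |phi x - m|, squared; the sign of [kappa] is not fixed, hence its
    absolute value. *)
Definition centered_bound : R := (`|kappa| + `|m|) ^+ 2.

Lemma centered_sqnorm_le x : ip (centered x) (centered x) <= centered_bound.
Proof.
have phi_le : `|phi x| <= `|kappa|.
  rewrite -(ler_pXn2r (ltn0Sn 1)) ?nnegrE // ip_norm -phi_feature.
  by rewrite real_normK ?num_real.
rewrite -ip_norm ler_pXn2r ?nnegrE ?addr_ge0 //.
by apply: le_trans (ler_normB _ _) _; rewrite lerD2r.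
Qed.

Lemma measurable_centered f : measurable_fun setT (fun x => ip (centered x) f).
Proof.
have -> : (fun x => ip (centered x) f) = (fun x => ip (phi x) f - ip m f).
  by apply/funext => x; rewrite ipBl.
apply: measurable_funB => //.
by case: (m_mean f) => /integrableP[/measurable_EFinP].
Qed.

(** [phi] is not assumed measurable as a map into [H]; joint measurability is recovered from that of
    [K] and the weak measurability of [phi]. *)
Lemma measurable_centered_gram :
  measurable_fun setT (fun z : X * X => ip (centered z.1) (centered z.2)).
Proof.
have -> : (fun z : X * X => ip (centered z.1) (centered z.2)) =
    (fun z => K z.1 z.2 - ip (phi z.1) m - ip (centered z.2) m).
  apply/funext => z; rewrite phi_feature ipBl ipBr (ipC ip m (_ - _)).
  by [].
have mphi : measurable_fun setT (fun x => ip (phi x) m).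
  by case: (m_mean m) => /integrableP[/measurable_EFinP].
apply: measurable_funB; first apply: measurable_funB => //.
- by apply: measurableT_comp mphi _; exact: measurable_fst.
- by apply: measurableT_comp (measurable_centered m) _; exact: measurable_snd.
Qed.

Let tensorE f g x : ip (tensor ip (phi x - m) (phi x - m) f) g =
  ip (centered x) f * ip (centered x) g.
Proof. by rewrite /tensor ipZl (ipC ip f). Qed.

Lemma integrable_form f g :
  rho.-integrable setT (EFin \o (fun x => ip (centered x) f * ip (centered x) g)).
Proof.
have [+ _] := M_cov f g; congr (rho.-integrable setT (EFin \o _)).
by apply/funext => x; rewrite tensorE.
Qed.

Lemma op_formE f g :
  ip (M f) g = \int[rho]_x (ip (centered x) f * ip (centered x) g).
Proof.
have [_ ->] := M_cov f g; congr Rintegral; apply/funext => x; exact: tensorE.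
Qed.

Lemma has_mean_form f g :
  has_mean rho (fun x => ip (centered x) f * ip (centered x) g) (ip (M f) g).
Proof.
split; first exact: integrable_form.
by rewrite op_formE /Rintegral fineK //; exact/integrable_fin_num/integrable_form.
Qed.

Lemma cov_sym f g : ip (M f) g = ip f (M g).
Proof.
rewrite (ipC ip f) !op_formE; congr Rintegral; apply/funext => x; exact: mulrC.
Qed.

Lemma ip_ext f g : (forall h, ip f h = ip g h) -> f = g.
Proof.
move=> fg; apply/eqP; rewrite -subr_eq0; apply/eqP/(ip_eq0 (ip := ip)).
by rewrite ipBl fg subrr.
Qed.

(** [M] is a bare function given by weak values; symmetry moves it to the other argument, where [ip]
    is linear. *)
Lemma cov_linear a f g : M (a *: f + g) = a *: M f + M g.
Proof.
apply: ip_ext => h.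
by rewrite ipDl ipZl !(cov_sym _ h) ipDl ipZl.
Qed.

Lemma cov_ge0 f : 0 <= ip (M f) f.
Proof. by rewrite op_formE Rintegral_ge0 // => x _; rewrite -expr2 sqr_ge0. Qed.

Lemma bessel n e f : orthonormal_upto ip n e ->
  \sum_(i < n) ip f (e i) ^+ 2 <= ip f f.
Proof.
move=> eON; rewrite [leRHS](bessel_residual f f eON) -[leLHS]addr0.
by apply: lerD; [apply: ler_sum|exact: ip_ge0].
Qed.

(** Bessel's inequality, pointwise for the centered features, is integrated. *)
Lemma cov_trace n e : orthonormal_upto ip n e ->
  \sum_(i < n) ip (M (e i)) (e i) <= centered_bound.
Proof.
move=> eON; apply: (has_mean_le (has_mean_sum (fun i : 'I_n => has_mean_form (e i) (e i)))).
move=> x; under eq_bigr do rewrite -expr2.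
exact: le_trans (bessel _ eON) (centered_sqnorm_le x).
Qed.

End Covariance.

(** Double sums of a product kernel are squares, which makes the error part of the discrepancy
    nonnegative. *)
Lemma sum_sqr_sums (R : comNzRingType) N n (h : 'I_n -> 'I_n -> 'I_N -> R) :
  \sum_i \sum_l \sum_j \sum_k h j k i * h j k l =
  \sum_j \sum_k (\sum_i h j k i) ^+ 2.
Proof.
under eq_bigr do rewrite exchange_big.
rewrite exchange_big; apply: eq_bigr => j _ /=.
under eq_bigr do rewrite exchange_big.
rewrite exchange_big; apply: eq_bigr => k _ /=.
by rewrite expr2 mulr_suml; apply: eq_bigr => i _; rewrite mulr_sumr.
Qed.

(** * The discrepancy statistic of a sample *)

Section GoodSample.
Context d d' (X : measurableType d) (T : measurableType d') (R : realType).
Variables (K : X -> X -> R) (kappa : R).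
Variables (H : completeNormedModType R) (ip : {dot H for idfun}).
Hypothesis ip_norm : norm_from_inner ip.
Variables (rho : probability X R) (phi : X -> H) (m : H) (M : H -> H).
Hypothesis K_meas : measurable_fun setT (fun z : X * X => K z.1 z.2).
Hypothesis K_bounded : forall x, K x x <= kappa ^+ 2.
Hypothesis phi_feature : feature_map ip K phi.
Hypothesis m_mean : is_expectation ip rho phi m.
Hypothesis M_cov : is_covariance ip rho phi m M.
Variables (D : nat -> R) (n : nat) (e : nat -> H) (eta : R).
Hypothesis D_ge0 : forall j, 0 <= D j.
Hypothesis D_le : forall j, D j <= D 0.
Hypothesis eON : orthonormal_upto ip n e.
Hypothesis e_eigen : forall j, (j < n)%N -> M (e j) = D j *: e j.
Hypothesis eta_ge0 : 0 <= eta.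
Hypothesis M_le : forall f,
  ip (M f) f <= \sum_(j < n) D j * ip f (e j) ^+ 2 + eta * ip f f.
Variable C : R.
Hypothesis C_ge0 : 0 <= C.

Let psi := centered phi m.
Let b := centered_bound kappa m.

Let psi_le x : ip (psi x) (psi x) <= b.
Proof. exact: (centered_sqnorm_le ip_norm m K_bounded phi_feature). Qed.

Let b_ge0 : 0 <= b. Proof. exact: sqr_ge0. Qed.

(** The contribution of one sample point to an entry of W - diag(D); it has mean zero for j, l <
    n. *)
Definition covariance_error (j l : nat) (u : X) : R :=
  ip (psi u) (e j) * ip (psi u) (e l) - D j * (j == l)%:R.

(* The first difference has mean at most [eta * b] and detects the spectrum
   missed by [e]; the products of errors have mean zero, so that their sum over
   a sample obeys the law of large numbers. *)
Definition discrepancy (z : X * X) : R :=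
  ip (psi z.1) (psi z.2) ^+ 2 -
    (\sum_(j < n) ip (psi z.1) (e j) * ip (psi z.2) (e j)) ^+ 2 +
  C * \sum_(j < n) \sum_(l < n)
        covariance_error j l z.1 * covariance_error j l z.2.

Lemma measurable_discrepancy : measurable_fun setT discrepancy.
Proof.
have mpsi f : measurable_fun setT (fun u => ip (psi u) f).
  exact: (measurable_centered m_mean).
have m1 f : measurable_fun setT (fun z : X * X => ip (psi z.1) f).
  by apply: measurableT_comp (mpsi f) _; exact: measurable_fst.
have m2 f : measurable_fun setT (fun z : X * X => ip (psi z.2) f).
  by apply: measurableT_comp (mpsi f) _; exact: measurable_snd.
have me j l : measurable_fun setT (covariance_error j l).
  by apply: measurable_funB => //; exact: measurable_funM.
apply: measurable_funD; first apply: measurable_funB.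
- apply: measurable_funX.
  exact: (measurable_centered_gram K_meas phi_feature m_mean).
- apply: measurable_funX; apply: measurable_sum => j; exact: measurable_funM.
- apply: measurable_funM => //; apply: measurable_sum => j.
  apply: measurable_sum => l; apply: measurable_funM.
    by apply: measurableT_comp (me j l) _; exact: measurable_fst.
  by apply: measurableT_comp (me j l) _; exact: measurable_snd.
Qed.

Definition discrepancy_bound : R :=
  b ^+ 2 + (n%:R * b) ^+ 2 + C * (n%:R * (n%:R * (b + D 0) ^+ 2)).

Let norm_ip_psi x y : `|ip (psi x) (psi y)| <= b.
Proof.
rewrite -(ler_pXn2r (ltn0Sn 1)) ?nnegrE // real_normK ?num_real //.
apply: le_trans (cauchy_schwarz ip _ _) _; rewrite expr2.
by apply: ler_pM => //; exact: ip_ge0.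
Qed.

Let norm_coef_mul u v j l : (j < n)%N -> (l < n)%N ->
  `|ip (psi u) (e j) * ip (psi v) (e l)| <= b.
Proof.
move=> jn ln.
have coef w k : (k < n)%N -> `|ip (psi w) (e k)| ^+ 2 <= b.
  move=> kn; rewrite real_normK ?num_real //.
  apply: le_trans (cauchy_schwarz ip _ _) _.
  by rewrite eON // eqxx mulr1.
rewrite normrM; have := coef u j jn; have := coef v l ln.
have := sqr_ge0 (`|ip (psi u) (e j)| - `|ip (psi v) (e l)|).
rewrite sqrrB; lra.
Qed.

Lemma discrepancy_le z : `|discrepancy z| <= discrepancy_bound.
Proof.
have sum_le (I : finType) (F : I -> R) c : (forall i, `|F i| <= c) ->
    `|\sum_i F i| <= #|I|%:R * c.
  move=> Fc; apply: le_trans (ler_norm_sum _ _ _) _.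
  by rewrite mulr_natl -sumr_const; apply: ler_sum.
apply: le_trans (ler_normD _ _) _; apply: lerD.
  apply: le_trans (ler_normB _ _) _; rewrite !normrX; apply: lerD.
    by rewrite ler_pXn2r ?nnegrE.
  rewrite ler_pXn2r ?nnegrE ?mulr_ge0 // -[n in leRHS]card_ord.
  by apply: (sum_le _ _ _) => j; exact: norm_coef_mul.
rewrite normrM (ger0_norm C_ge0) ler_wpM2l // -[n in X in _ <= X * _]card_ord.
apply: (sum_le _ _ _) => j; rewrite -[n in X in _ <= X * _]card_ord.
apply: (sum_le _ _ _) => l; rewrite normrM expr2.
have err u : `|covariance_error j l u| <= b + D 0.
  apply: le_trans (ler_normB _ _) _; apply: lerD; first exact: norm_coef_mul.
  rewrite normrM (ger0_norm (D_ge0 _)); case: (_ == _); rewrite ?normr1 ?mulr1 //.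
  by rewrite normr0 mulr0.
by apply: ler_pM.
Qed.

(** Averaging over the second point turns the first difference into <M f, f> - sum D_j <f, e_j>^2 at
    f = psi u, which is at most eta |f|^2; the error products vanish because <M e_j, e_l> = D_j
    [j = l]. *)
Lemma discrepancy_mean_le u :
  (\int[rho]_v (discrepancy (u, v))%:E <= (eta * b)%:E)%E.
Proof.
pose a j := ip (psi u) (e j).
have means := has_meanD (has_meanD
  (has_mean_form M_cov (psi u) (psi u))
  (has_meanZ (-1) (has_mean_sum (fun j : 'I_n => has_mean_sum (fun l : 'I_n =>
     has_meanZ (a j * a l) (has_mean_form M_cov (e j) (e l)))))))
  (has_meanZ C (has_mean_sum (fun j : 'I_n => has_mean_sum (fun l : 'I_n =>
     has_meanZ (covariance_error j l u)
       (has_meanD (has_mean_form M_cov (e j) (e l))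
         (has_mean_cst rho (- (D j * (j == l)%:R)))))))).
have [_ intE] := means.
have -> : (\int[rho]_v (discrepancy (u, v))%:E =
  \int[rho]_x (ip (centered phi m x) (psi u) * ip (centered phi m x) (psi u) +
      -1 * (\sum_(j < n) \sum_(l < n) a j * a l *
         (ip (centered phi m x) (e j) * ip (centered phi m x) (e l))) +
      C * (\sum_(j < n) \sum_(l < n) covariance_error j l u *
         (ip (centered phi m x) (e j) * ip (centered phi m x) (e l) +
          - (D j * (j == l)%:R))))%:E)%E.
  apply: eq_integral => v _; congr EFin; rewrite /discrepancy /= -/psi.
  rewrite -expr2 (ipC ip (psi v) (psi u)) mulN1r; congr (_ - _ + _).
  rewrite expr2 mulr_suml; apply: eq_bigr => j _; rewrite mulr_sumr.
  by apply: eq_bigr => l _; rewrite /a; ring.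
rewrite intE lee_fin.
have Mee (j l : 'I_n) : ip (M (e j)) (e l) = D j * (j == l)%:R.
  by rewrite e_eigen // ipZl eON.
rewrite [X in _ + C * X]big1 ?mulr0 ?addr0 => [|j _]; last first.
  by rewrite big1 // => l _; rewrite Mee subrr mulr0.
have -> : \sum_(j < n) \sum_(l < n) a j * a l * ip (M (e j)) (e l) =
    \sum_(j < n) D j * ip (psi u) (e j) ^+ 2.
  apply: eq_bigr => j _; rewrite (bigD1 j) //= big1 ?addr0 => [|l /negbTE lj].
    by rewrite Mee eqxx mulr1 mulrC expr2.
  by rewrite Mee eq_sym lj !mulr0.
have := M_le (psi u).
have : eta * ip (psi u) (psi u) <= eta * b by rewrite ler_wpM2l.
lra.
Qed.

Lemma sum_discrepancy N (y : 'I_N -> X) :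
  \sum_i \sum_l discrepancy (y i, y l) =
  \sum_i \sum_l (ip (psi (y i)) (psi (y l)) ^+ 2 -
    (\sum_(j < n) ip (psi (y i)) (e j) * ip (psi (y l)) (e j)) ^+ 2) +
  C * \sum_(j < n) \sum_(l < n) (\sum_i covariance_error j l (y i)) ^+ 2.
Proof.
rewrite -sum_sqr_sums mulr_sumr -big_split; apply: eq_bigr => i _ /=.
by rewrite mulr_sumr -big_split.
Qed.

Lemma sum_discrepancy_ge0 N (y : 'I_N -> X) :
  0 <= \sum_i \sum_l discrepancy (y i, y l).
Proof.
rewrite sum_discrepancy addr_ge0 ?mulr_ge0 //; first exact: gram_residual_ge0.
by apply: sumr_ge0 => j _; apply: sumr_ge0 => l _; exact: sqr_ge0.
Qed.

(** Both parts of the sum are nonnegative, so each is bounded by the whole; C tau^2 = c turns the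
    bound on the squared errors into accuracy [tau] for W. *)
Lemma small_discrepancy N (y : 'I_N -> X) (c tau : R) : (0 < N)%N ->
  0 < tau -> C * tau ^+ 2 = c -> 0 < c ->
  \sum_i \sum_l discrepancy (y i, y l) < c * N%:R ^+ 2 ->
  \sum_i \sum_l (ip (psi (y i)) (psi (y l)) ^+ 2 -
    (\sum_(j < n) ip (psi (y i)) (e j) * ip (psi (y l)) (e j)) ^+ 2)
      <= c * N%:R ^+ 2 /\
  forall j l, (j < n)%N -> (l < n)%N ->
    `|N%:R^-1 * (\sum_i ip (psi (y i)) (e j) * ip (psi (y i)) (e l)) -
       D j * (j == l)%:R| <= tau.
Proof.
move=> N0 tau0 Cc c0; rewrite sum_discrepancy => small.
have N0' : 0 < N%:R :> R by rewrite ltr0n.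
have res0 := gram_residual_ge0 (fun i => psi (y i)) eON.
have err0 : 0 <= C * \sum_(j < n) \sum_(l < n) (\sum_i covariance_error j l (y i)) ^+ 2.
  by rewrite mulr_ge0 // sumr_ge0 // => j _; rewrite sumr_ge0 // => l _; exact: sqr_ge0.
split; first by lra.
move=> j l jn ln.
have le_all : (\sum_i covariance_error j l (y i)) ^+ 2 <=
    \sum_(j < n) \sum_(l < n) (\sum_i covariance_error j l (y i)) ^+ 2.
  rewrite (bigD1 (Ordinal jn)) //= (bigD1 (Ordinal ln)) //= -addrA lerDl.
  by rewrite addr_ge0 ?sumr_ge0 // => i _; rewrite ?sumr_ge0 // => *; exact: sqr_ge0.
have C0 : 0 < C.
  by rewrite lt_neqAle C_ge0 andbT eq_sym; apply/eqP => C0; move: c0; rewrite -Cc C0 mul0r ltxx.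
have sq_le : (\sum_i covariance_error j l (y i)) ^+ 2 <= (tau * N%:R) ^+ 2.
  rewrite -(ler_pM2l C0).
  have -> : C * (tau * N%:R) ^+ 2 = c * N%:R ^+ 2 by rewrite -Cc; ring.
  have := ler_wpM2l C_ge0 le_all; lra.
have abs_le : `|\sum_i covariance_error j l (y i)| <= tau * N%:R.
  by rewrite -(ler_pXn2r (ltn0Sn 1)) ?nnegrE ?mulr_ge0 ?(ltW tau0) // real_normK ?num_real.
have -> : N%:R^-1 * (\sum_i ip (psi (y i)) (e j) * ip (psi (y i)) (e l)) -
       D j * (j == l)%:R = N%:R^-1 * \sum_i covariance_error j l (y i).
  rewrite /covariance_error sumrB sumr_const card_ord -[(D j * _) *+ N]mulr_natl mulrBr.
  by rewrite [N%:R^-1 * (N%:R * _)]mulrA mulVf ?mul1r // gt_eqF.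
by rewrite normrM (@ger0_norm _ N%:R^-1) ?invr_ge0 ?(ltW N0') // [leLHS]mulrC ler_pdivrMr.
Qed.

Variables (P : probability T R) (N : nat) (x : 'I_N -> {RV P >-> X}).
Hypothesis x_iid : iid_sample rho x.

Definition discrepant (c : R) : set T :=
  [set w | c * N%:R ^+ 2 <= \sum_i \sum_l discrepancy (x i w, x l w)].

Lemma measurable_discrepant c : measurable (discrepant c).
Proof.
have mS : measurable_fun setT
    (fun w => \sum_i \sum_l discrepancy (x i w, x l w)).
  apply: measurable_sum => i; apply: measurable_sum => l.
  by apply: measurableT_comp measurable_discrepancy _; exact: measurable_pair.
by rewrite -[discrepant c]setTI; exact: measurable_fun_le.
Qed.

Lemma probability_discrepant c : (0 < N)%N -> 0 < c ->
  (P (discrepant c) <= ((eta * b + discrepancy_bound / N%:R) / c)%:E)%E.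
Proof.
move=> N0 c0.
apply: (vstat_tail x_iid measurable_discrepancy discrepancy_le _ c0 N0) => //.
- exact: mulr_ge0.
- exact: discrepancy_mean_le.
- by move=> w; exact: (sum_discrepancy_ge0 (fun i => x i w)).
Qed.

End GoodSample.

(** * Measurability of the eigenvalues *)

Section Measurability.
Context d (T : measurableType d) (R : realType).

Lemma measurable_fun_invr (f : T -> R) : measurable_fun setT f ->
  measurable_fun setT (fun w => (f w)^-1).
Proof.
move=> mf; apply: (measurableT_comp _ mf).
(* Inversion is continuous only away from 0, so the singleton is handled separately. *)
rewrite -(setUv [set (0 : R)]); apply/measurable_funU => //.
  exact: measurableC.
split; first exact: measurable_fun_set1.
apply: open_continuous_measurable_fun.
  exact/closed_openC/accessible_closed_set1/hausdorff_accessible/Rhausdorff.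
by move=> z /set_mem/= /eqP z0; exact: inv_continuous.
Qed.

Lemma measurable_mx_power n (A : T -> 'M[R]_n) k i j :
  (forall i j, measurable_fun setT (fun w => A w i j)) ->
  measurable_fun setT (fun w => (A w ^+ k) i j).
Proof.
move=> mA; elim: k i j => [|k IHk] i j.
  by under eq_fun do rewrite expr0; exact: measurable_cst.
under [fun w => _]eq_fun do rewrite exprS -[_ * _]/(_ *m _) mxE.
by apply: measurable_sum => l; exact: measurable_funM.
Qed.

Lemma measurable_set_gt (f : T -> R) c : measurable_fun setT f ->
  measurable [set w | c < f w].
Proof.
move=> mf; have -> : [set w | c < f w] = ~` [set w | f w <= c].
  by apply/seteqP; split=> w /=; rewrite ltNge => /negP.
apply: measurableC; rewrite -[X in measurable X]setTI.
by apply: measurable_fun_le.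
Qed.

Lemma measurable_fun_gt (f : T -> R) : (forall c, measurable [set w | c < f w]) ->
  measurable_fun setT f.
Proof.
move=> mf mD; apply: (measurability _ (RGenOInfty.measurableE R)) => //.
by move=> _ [_ [c ->] <-]; rewrite setTI preimage_itvoy; exact: mf.
Qed.

(* Once the larger eigenvalues are known to be measurable, so is the tail power
   sum [g p], and [s_k > c] if and only if [g p > N c^p] for some [p]. *)
Lemma measurable_eigenvalue N (A : T -> 'M[R]_N) (s : T -> seq R) k :
  (forall i j, measurable_fun setT (fun w => A w i j)) ->
  (forall w, (A w)^T = A w) -> (forall w, matrix_eigenvalues (A w) (s w)) ->
  (forall w i, 0 <= (s w)`_i) ->
  measurable_fun setT (fun w => (s w)`_k).
Proof.
move=> mA symA sA s_ge0; elim/ltn_ind: k => k IHk.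
have [Nk|kN] := leqP N k.
  rewrite (_ : (fun w => _) = cst 0); first exact: measurable_cst.
  apply/funext => w; rewrite nth_default //.
  by rewrite (size_char_roots (proj2 (sA w))).
pose g p w := \tr (A w ^+ p) - \sum_(i < k) (s w)`_i ^+ p.
have mg p : measurable_fun setT (g p).
  apply: measurable_funB.
    by apply: measurable_sum => i; exact: measurable_mx_power.
  by apply: measurable_sum => i; apply: measurable_funX; exact: IHk.
have gE p w : g p w = \sum_(k <= i < N) (s w)`_i ^+ p.
  rewrite /g (trace_power (symA w) (proj2 (sA w))).
  rewrite -!(big_mkord xpredT (fun i => (s w)`_i ^+ p)).
  by rewrite (big_cat_nat (leq0n k) (ltnW kN)) //= addrC addrK.
apply: measurable_fun_gt => c.
have [c0|c0] := ltP c 0.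
  rewrite (_ : [set w | _] = setT) //; apply/seteqP; split=> // w _ /=.
  exact: lt_le_trans (s_ge0 w k).
(* If q = s_k > c >= 0, then (c / q)^p tends to 0 and q^p eventually exceeds N c^p; if s_k <= c, the
   at most N tail terms are each at most c^p. *)
rewrite (_ : [set w | _] = \bigcup_p [set w | N%:R * c ^+ p < g p w]); last first.
  apply/seteqP; split=> w /= => [cs|[p _ /=]].
    pose q := (s w)`_k; have q0 : 0 < q by exact: le_lt_trans cs.
    have [p hp] : exists p, N%:R * c ^+ p < q ^+ p.
      have cq : `|c / q| < 1.
        by rewrite ger0_norm ?divr_ge0 ?(ltW q0) // ltr_pdivrMr // mul1r.
      have N1 : 0 < N.+1%:R^-1 :> R by rewrite invr_gt0.
      have /cvgrPdist_lt/(_ _ N1)/filter_ex[p] := cvg_expr cq.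
      rewrite sub0r normrN ger0_norm ?exprn_ge0 ?divr_ge0 ?(ltW q0) // => hp.
      exists p; have qp : 0 < q ^+ p by rewrite exprn_gt0.
      rewrite -[ltRHS]mul1r -ltr_pdivrMr // -mulrA -expr_div_n.
      have := ltr_pM2l (ltr0Sn R N) ((c / q) ^+ p) N.+1%:R^-1.
      rewrite hp mulfV // => lt1; apply: le_lt_trans lt1.
      by rewrite ler_wpM2r ?exprn_ge0 ?divr_ge0 ?(ltW q0) // ler_nat.
    exists p => //=; apply: lt_le_trans hp _.
    rewrite gE (big_ltn kN) lerDl; apply: sumr_ge0 => i _.
    exact: exprn_ge0.
  rewrite gE; apply: contraTT; rewrite -!leNgt => sc.
  apply: le_trans (_ : \sum_(k <= i < N) c ^+ p <= _).
    rewrite big_nat [leRHS]big_nat; apply: ler_sum => i /andP[ki iN].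
    apply: lerXn2r; rewrite ?nnegrE //; apply: le_trans sc.
    apply: (sorted_leq_nth (rev_trans le_trans) lexx);
      rewrite ?inE ?(size_char_roots (proj2 (sA w))) //.
    exact: (proj1 (sA w)).
  rewrite sumr_const_nat -[_ *+ _]mulr_natl ler_wpM2r ?exprn_ge0 //.
  by rewrite ler_nat leq_subr.
by apply: bigcup_measurable => p _; exact: measurable_set_gt.
Qed.

End Measurability.

(** * Consistency *)

Section Consistency.
Context d d' (X : measurableType d) (T : measurableType d') (R : realType).
Variables (K : X -> X -> R) (kappa : R).
Variables (H : completeNormedModType R) (ip : {dot H for idfun}).
Hypothesis ip_norm : norm_from_inner ip.
Variables (rho : probability X R) (phi : X -> H) (m : H) (M : H -> H).
Hypothesis K_meas : measurable_fun setT (fun z : X * X => K z.1 z.2).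
Hypothesis K_bounded : forall x, K x x <= kappa ^+ 2.
Hypothesis phi_feature : feature_map ip K phi.
Hypothesis m_mean : is_expectation ip rho phi m.
Hypothesis M_cov : is_covariance ip rho phi m M.
Variables (D : nat -> R) (P : probability T R).
Hypothesis D_eigen : eigenvalue_seq M D.

(** [N0] is chosen before the sample, so samples of different sizes may be unrelated; the
    exceptional set [A] is chosen before the spectrum [s]. *)
Lemma gram_eigenvalues_consistent r (delta eps : R) : (0 < r)%N ->
  0 < D r.-1 -> 0 < delta -> 0 < eps ->
  exists N0, forall N (x : 'I_N -> {RV P >-> X}), (N0 <= N)%N ->
    iid_sample rho x ->
    exists A : set T, [/\ measurable A, (P A <= eps%:E)%E &
      forall w s, ~ A w ->
        matrix_eigenvalues (normalized_gram ip phi m (fun i => x i w)) s ->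
        forall k, (k < r)%N -> `|s`_k - D k| <= delta].
Proof.
move=> r0 Dr0 delta0 eps0; have [D_dec D_ge0 _] := D_eigen.
have D_le j : D j <= D 0 by exact: D_dec.
pose b := centered_bound kappa m; have b0 : 0 <= b by exact: sqr_ge0.
(* The error delta^2 is shared equally between the residual and the entry errors of W. *)
pose c := delta ^+ 2 / 2; have c0 : 0 < c by rewrite divr_gt0 ?exprn_gt0.
(* The mean eta b accounts for half of the failure probability, the diagonal term B / N for the
   other half; b + 1 avoids division by zero. *)
pose eta := eps * c / (2 * (b + 1)).
have b1 : 0 < b + 1 by rewrite ltr_pwDr.
have eta0 : 0 < eta by rewrite divr_gt0 ?mulr_gt0.
have eta_b : eta * b <= eps * c / 2.
  have -> : eps * c / 2 = eta * (b + 1) by rewrite /eta; field; rewrite gt_eqF.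
  by rewrite ler_wpM2l ?(ltW eta0) // lerDl.
have [n [e [rn [eON e_eigen] M_le]]] := spectral_cutoff ip_norm
  (cov_sym M_cov) (cov_linear M_cov) (cov_ge0 M_cov)
  (cov_trace ip_norm K_bounded phi_feature M_cov) D_eigen eta0 r0 Dr0.
have n0 : 0 < n%:R :> R by rewrite ltr0n (leq_trans r0 rn).
pose C0 := n%:R ^+ 2 * (4 * D 0 + 1).
have C00 : 0 < C0 by rewrite mulr_gt0 ?exprn_gt0 // ltr_pwDr // mulr_ge0.
(* The second bound serves the lower estimate of the eigenvalues, the other two the upper estimate
   of their squares. *)
pose tau := Num.min 1 (Num.min (delta / n%:R) (c / C0)).
have tau0 : 0 < tau.
  by rewrite !lt_min ltr01 (divr_gt0 delta0 n0) (divr_gt0 c0 C00).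
have tau1 : tau <= 1 by rewrite ge_min lexx.
have tau_n : n%:R * tau <= delta.
  by rewrite mulrC -ler_pdivlMr // !ge_min lexx orbT.
have tau_C : C0 * tau <= c.
  by rewrite mulrC -ler_pdivlMr // !ge_min lexx !orbT.
pose C := c / tau ^+ 2.
have C_ge0 : 0 <= C by rewrite divr_ge0 ?(ltW c0) // sqr_ge0.
have Cc : C * tau ^+ 2 = c by rewrite divfK // expf_neq0 // gt_eqF.
pose B := discrepancy_bound kappa m D n C.
(* The first entry provides at least [n] sample points, the second makes B / N <= eps c / 2. *)
pose N0 := (maxn n.+1 (Num.truncn (2 * B / (eps * c))).+1).
exists N0 => N x; rewrite geq_max => /andP[nN BN] x_iid.
have N_gt0 : (0 < N)%N by exact: leq_trans nN.
have NR : 0 < N%:R :> R by rewrite ltr0n.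
exists (discrepant ip phi m D n e C x c); split.
- exact: (measurable_discrepant K_meas phi_feature m_mean).
- apply: le_trans (probability_discrepant ip_norm K_meas K_bounded phi_feature
    m_mean M_cov D_ge0 D_le eON e_eigen (ltW eta0) M_le C_ge0 x_iid N_gt0 c0) _.
  rewrite lee_fin ler_pdivrMr // -/b -/B.
  have : B / N%:R <= eps * c / 2.
    rewrite ler_pdivrMr //.
    have : 2 * B / (eps * c) <= N%:R.
      by apply: le_trans (ltW (truncnS_gt _)) _; rewrite ler_nat.
    by rewrite ler_pdivrMr ?mulr_gt0 //; lra.
  lra.
- move=> w s /negP; rewrite -ltNge => small s_eigen k kr.
  have kn : (k < n)%N by exact: leq_trans kr rn.
  have [res W_near] := small_discrepancy eON C_ge0 N_gt0 tau0 Cc c0 small.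
  apply: (gram_eigenvalue_near N_gt0 s_eigen eON D_dec D_ge0 (ltW tau0) W_near
    tau1 D_le res kn (ltnW nN) (ltW delta0) tau_n).
  rewrite -/C0 (_ : delta ^+ 2 = c + c) ?lerD2l //.
  by rewrite /c; field.
Qed.

End Consistency.

(** * Continuity and measurability of spectral profiles *)

Section Profile.
Variables (R : realType) (r : nat).

Lemma cvg_fin_sum (U : Type) (F : set_system U) (FF : Filter F) (I : finType)
    (f : I -> U -> R) (a : I -> R) :
  (forall i, f i u @[u --> F] --> a i) ->
  \sum_i f i u @[u --> F] --> \sum_i a i.
Proof.
move=> fa; elim: (index_enum I) => [|i s IHs].
  by rewrite big_nil; under eq_fun do rewrite big_nil; exact: cvg_cst.
rewrite big_cons; under eq_fun do rewrite big_cons.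
by apply: cvgD => //; exact: fa.
Qed.

(** Stated for pairs, it serves both conclusions: with D1 = D2 and s2 = D2 it controls a single
    profile, the limiting distance being 0. *)
Lemma profile_dist_continuous (D1 D2 : nat -> R) (eps : R) :
  \sum_(i < r) D1 i != 0 -> \sum_(i < r) D2 i != 0 -> 0 < eps ->
  exists2 delta : R, 0 < delta & forall s1 s2 : nat -> R,
    (forall k, (k < r)%N -> `|s1 k - D1 k| <= delta) ->
    (forall k, (k < r)%N -> `|s2 k - D2 k| <= delta) ->
    `|dist2 (spectral_profile r s1) (spectral_profile r s2) -
      dist2 (spectral_profile r D1) (spectral_profile r D2)| <= eps.
Proof.
move=> S1 S2 eps0.
pose V := 'rV[R]_r; pose row (s : nat -> R) : V := \row_j s j.
pose G (p : V * V) := Num.sqrt (\sum_j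
  (p.1 0 j / (\sum_i p.1 0 i) - p.2 0 j / (\sum_i p.2 0 i)) ^+ 2).
have GE s1 s2 : dist2 (spectral_profile r s1) (spectral_profile r s2) =
    G (row s1, row s2).
  rewrite /dist2 /norm2 /G /=; congr Num.sqrt; apply: eq_bigr => j _.
  rewrite !mxE; congr ((_ / _ - _ / _) ^+ 2); apply: eq_bigr => i _; by rewrite mxE.
have c1 j : (p.1 : V) 0 j @[p --> (row D1, row D2)] --> row D1 0 j.
  apply: (@cvg_comp _ _ _ fst (fun u : V => u 0 j) _ (nbhs (row D1))).
    exact: cvg_fst.
  exact: coord_continuous.
have c2 j : (p.2 : V) 0 j @[p --> (row D1, row D2)] --> row D2 0 j.
  apply: (@cvg_comp _ _ _ snd (fun u : V => u 0 j) _ (nbhs (row D2))).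
    exact: cvg_snd.
  exact: coord_continuous.
have row_sum s : \sum_i row s 0 i = \sum_(i < r) s i.
  by apply: eq_bigr => i _; rewrite mxE.
have Gc : G p @[p --> (row D1, row D2)] --> G (row D1, row D2).
  apply: (@continuous_cvg _ _ _ _ _ _ (@Num.sqrt R)); first exact: sqrt_continuous.
  apply: cvg_fin_sum => j; under eq_fun do rewrite expr2; rewrite expr2.
  have c : (p.1 : V) 0 j / (\sum_i (p.1 : V) 0 i) - (p.2 : V) 0 j / (\sum_i (p.2 : V) 0 i)
      @[p --> (row D1, row D2)] -->
      row D1 0 j / (\sum_i row D1 0 i) - row D2 0 j / (\sum_i row D2 0 i).
    apply: cvgB; apply: cvgM => //; apply: cvgV; rewrite ?row_sum //;
      rewrite -row_sum; exact: cvg_fin_sum.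
  exact: cvgM.
have /cvgrPdist_le/(_ _ eps0)/nbhs_ballP[delta /= delta0 ball_eps] := Gc.
(* The hypotheses on s1 and s2 are nonstrict while balls are strict, hence the half. *)
exists (delta / 2); first by rewrite divr_gt0.
move=> s1 s2 near1 near2; rewrite !GE distrC; apply: ball_eps.
have ball_row s D : (forall k, (k < r)%N -> `|s k - D k| <= delta / 2) ->
    ball (row D) delta (row s).
  move=> sD; split=> // i j; rewrite ord1 /ball /= !mxE distrC.
  apply: le_lt_trans (sD _ (ltn_ord j)) _; lra.
by split; exact: ball_row.
Qed.

End Profile.

Lemma cvg_probability0 d (T : measurableType d) (R : realType)
    (P : probability T R) (I : Type) (F : set_system I) (A : I -> set T) :
  Filter F ->
  (forall eps : R, 0 < eps -> \forall i \near F, (P (A i) <= eps%:E)%E) ->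
  P (A i) @[i --> F] --> 0%E.
Proof.
move=> FF small; apply/fine_cvgP; split.
  apply: filterS (small _ ltr01) => i le1.
  by rewrite ge0_fin_numE // (le_lt_trans le1) // ltry.
apply/cvgrPdist_le => eps eps0; apply: filterS (small _ eps0) => i le_eps /=.
rewrite sub0r normrN ger0_norm ?fine_ge0 // -lee_fin fineK //.
by rewrite ge0_fin_numE // (le_lt_trans le_eps) // ltry.
Qed.

Lemma measurable_profile_dist d (T : measurableType d) (R : realType) r
    (u v : T -> nat -> R) :
  (forall j, measurable_fun setT (fun w => u w j)) ->
  (forall j, measurable_fun setT (fun w => v w j)) ->
  measurable_fun setT
    (fun w => dist2 (spectral_profile r (u w)) (spectral_profile r (v w))).
Proof.
move=> mu mv.
apply: (measurableT_comp (f := @Num.sqrt R)).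
  apply: continuous_measurable_fun; exact: sqrt_continuous.
apply: measurable_sum => j; apply: measurable_funX.
under eq_fun do rewrite !mxE.
apply: measurable_funB; apply: measurable_funM => //;
  apply: measurable_fun_invr; exact: measurable_sum.
Qed.

Lemma dist2xx (R : realType) n (u : 'rV[R]_n) : dist2 u u = 0.
Proof.
rewrite /dist2 /norm2 subrr big1 ?sqrtr0 // => j _.
by rewrite mxE expr0n.
Qed.

(** The spectra are prescribed outcome by outcome; they are measurable because the Gram matrix
    determines them. *)
Lemma measurable_gram_eigenvalue d d' (X : measurableType d)
    (T : measurableType d') (R : realType) (K : X -> X -> R)
    (H : completeNormedModType R) (ip : {dot H for idfun})
    (rho : probability X R) (phi : X -> H) (m : H) (P : probability T R) N
    (x : 'I_N -> {RV P >-> X}) (s : T -> seq R) k :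
  norm_from_inner ip -> measurable_fun setT (fun z : X * X => K z.1 z.2) ->
  feature_map ip K phi -> is_expectation ip rho phi m ->
  (forall w, matrix_eigenvalues
     (normalized_gram ip phi m (fun i => x i w)) (s w)) ->
  measurable_fun setT (fun w => (s w)`_k).
Proof.
move=> ip_norm K_meas phi_feature m_mean s_eigen.
apply: (measurable_eigenvalue (A := fun w =>
  normalized_gram ip phi m (fun i => x i w))) => //.
- move=> i j; under eq_fun do rewrite !mxE.
  apply: measurable_funM => //.
  exact: (measurableT_comp
    (measurable_centered_gram K_meas phi_feature m_mean) (measurable_pair x i j)).
- by move=> w; apply/matrixP => i j; rewrite !mxE ipC.
by move=> w i; exact: (gram_eigenvalues_ge0 (y := fun i => phi (x i w) - m) (s_eigen w)).
Qed.

Lemma probability_le_good d (T : measurableType d) (R : realType)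
    (P : probability T R) (A E : set T) (eps : R) :
  measurable A -> measurable E -> (P A <= eps%:E)%E ->
  (forall w, ~ A w -> ~ E w) -> (P E <= eps%:E)%E.
Proof.
move=> mA mE PA AE; apply: le_trans PA; apply: le_measure; [exact: mem_set|exact: mem_set|].
by move=> w Ew; apply: contrapT => /AE.
Qed.

Unset Implicit Arguments.

Theorem theoremS13p3 (R : realType)
  (* the kernel, its RKHS and its feature map *)
  (d : measure_display) (X : measurableType d) (K : X -> X -> R) (kappa : R)
  (H : completeNormedModType R) (ip : {dot H for idfun}) (ev : H -> X -> R)
  (phi : X -> H)
  (* the two distributions; k = 1, 2 is the index k : 'I_2 *)
  (rho : 'I_2 -> probability X R) (r : nat)
  (m : 'I_2 -> H) (M : 'I_2 -> H -> H) (D : 'I_2 -> nat -> R)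
  (* for each sample size N, a sample of size N, and its Gram eigenvalues *)
  (d' : measure_display) (T : measurableType d') (P : probability T R)
  (x : 'I_2 -> forall N : nat, 'I_N -> {RV P >-> X})
  (Dhat : 'I_2 -> nat -> T -> seq R)
  (K_mercer : mercer_kernel K)
  (K_bounded : forall y, K y y <= kappa ^+ 2)
  (H_rkhs : is_rkhs ip ev K)
  (phi_feature : feature_map ip K phi)
  (r_ge1 : (1 <= r)%N)
  (m_mean : forall k, is_expectation ip (rho k) phi (m k))
  (M_cov : forall k, is_covariance ip (rho k) phi (m k) (M k))
  (D_eigen : forall k, eigenvalue_seq (M k) (D k))
  (D_gap : forall k, gapped r (D k))
  (x_iid : forall k N, iid_sample (rho k) (x k N))
  (Dhat_eigen : forall k N w,
     matrix_eigenvalues (normalized_gram ip phi (m k) (fun i => x k N i w))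
                        (Dhat k N w)) :
  let Pi k := spectral_profile r (D k) in
  let Pihat k N w := spectral_profile r (nth 0 (Dhat k N w)) in
  let dr := dist2 (Pi ord0) (Pi ord_max) in
  let drhat (N : nat * nat) w :=
    dist2 (Pihat ord0 N.1 w) (Pihat ord_max N.2 w) in
  (forall k : 'I_2,
     cvg_in_probability P \oo (@dist2 R r) (Pihat k) (Pi k)) /\
  cvg_in_probability P (filter_prod \oo \oo) (fun a b : R => `|a - b|)
    drhat dr.
Proof.
move=> Pi Pihat dr drhat.
have [ip_norm _ _ _] := H_rkhs; have [_ _ K_meas] := K_mercer.
(* The gap at r, with D r >= 0, makes the last summand positive, so the normalizing sum does not
   vanish. *)
have D_sum k : \sum_(i < r) D k i != 0.
  have [_ D_ge0 _] := D_eigen k.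
  rewrite -(prednK r_ge1) big_ord_recr /= gt_eqF // ltr_wpDl ?sumr_ge0 //.
  exact: le_lt_trans (D_ge0 r) (proj1 (D_gap k)).
have meas k N j : measurable_fun setT (fun w => nth 0 (Dhat k N w) j).
  exact: (measurable_gram_eigenvalue _ ip_norm K_meas phi_feature (m_mean k)
    (Dhat_eigen k N)).
have good k (delta eps : R) : 0 < delta -> 0 < eps -> exists N0, forall N,
    (N0 <= N)%N -> exists A : set T, [/\ measurable A, (P A <= eps%:E)%E &
      forall w, ~ A w -> forall j, (j < r)%N ->
        `|nth 0 (Dhat k N w) j - D k j| <= delta].
  move=> delta0 eps0.
  have Dr0 : 0 < D k r.-1.
    have [_ D_ge0 _] := D_eigen k.
    exact: le_lt_trans (D_ge0 r) (proj1 (D_gap k)).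
  have [N0 hN0] := gram_eigenvalues_consistent ip_norm K_meas K_bounded
    phi_feature (m_mean k) (M_cov k) P (D_eigen k) r_ge1 Dr0 delta0 eps0.
  exists N0 => N N0N; have [A [mA PA hA]] := hN0 N (x k N) N0N (x_iid k N).
  exists A; split=> // w Aw; exact: hA Aw (Dhat_eigen k N w).
split=> [k eps eps0|eps eps0].
  apply: cvg_probability0 => e e0.
  have [delta delta0 hdelta] :=
    profile_dist_continuous (D_sum k) (D_sum k) eps0.
  have [N0 hN0] := good k _ _ delta0 e0.
  exists N0 => // N /= /hN0[A [mA PA hA]].
  apply: (probability_le_good mA _ PA) => [|w /hA near_w].
    by apply: measurable_set_gt; apply: measurable_profile_dist => j;
      [exact: meas|exact: measurable_cst].
  apply/negP; rewrite -leNgt -[leLHS]subr0 -(dist2xx (spectral_profile r (D k))).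
  apply: le_trans (ler_norm _) (hdelta _ _ near_w _) => j _.
  by rewrite subrr normr0 ltW.
(* Each sample gets half of [e]; the union bound joins the exceptional sets whatever the joint law
   of the two samples. *)
apply: cvg_probability0 => e e0; have e2 : 0 < e / 2 by rewrite divr_gt0.
have [delta delta0 hdelta] :=
  profile_dist_continuous (D_sum ord0) (D_sum ord_max) eps0.
have [N0 hN0] := good ord0 _ _ delta0 e2.
have [N1 hN1] := good ord_max _ _ delta0 e2.
exists ([set n | (N0 <= n)%N], [set n | (N1 <= n)%N]).
  by split; [exists N0|exists N1].
move=> [n0 n1] /= [/hN0[A0 [mA0 PA0 hA0]] /hN1[A1 [mA1 PA1 hA1]]].
have mA : measurable (A0 `|` A1) by exact: measurableU.
have PA : (P (A0 `|` A1) <= e%:E)%E.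
  apply: le_trans (measureU2 P mA0 mA1) _.
  by rewrite (splitr e) EFinD; exact: leeD.
apply: (probability_le_good mA _ PA) => [|w nA].
  apply: measurable_set_gt; apply: measurableT_comp => //.
  apply: measurable_funB => //; apply: measurable_profile_dist => j; exact: meas.
apply/negP; rewrite -leNgt; apply: hdelta.
  by apply: hA0 => A0w; apply: nA; left.
by apply: hA1 => A1w; apply: nA; right.
Qed.
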